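(* Let $E$ be a Polish space and let $L^{(2)}$ be the operator on $C_b(E^2)$ $$L^{(2)}\varphi_2(z_1,z_2)=\lambda(z_1,z_2)\iint_{E\times E}\{\varphi_2(z_1',z_2')-\varphi_2(z_1,z_2)\}\,\Gamma^{(2)}(z_1,z_2,\mathrm{d}z_1',\mathrm{d}z_2')$$ where $\lambda$ and $\Gamma^{(2)}$ satisfy the assumptions listed in the context, and assume that $\sup_{z_1,z_2\in E}\lambda(z_1,z_2)\leq\Lambda<\infty$. Let $(f^N_0)_N$ be a sequence of symmetric probability measures on $E^N$ which is $f_0$-chaotic for a given $f_0\in\mathcal{P}(E)$. Let $(\mathcal{Z}^N_t)_t$ be the $N$-particle process with initial law $f^N_0$ and with generator $$\mathcal{L}_N\varphi_N=\frac1N\sum_{i<j}L^{(2)}\diamond_{ij}\varphi_N.$$ Then for any $t>0$ there exists $f_t\in\mathcal{P}(E)$ such that for every integer $s\geq1$ and every $\varphi_s\in C_b(E^s)$, $$\mathbb{E}\big[\varphi_s(\mathcal{Z}^{s,N}_t)\big]\underset{N\to+\infty}{\longrightarrow}\langle f_t^{\otimes s},\varphi_s\rangle,$$ where $\mathcal{Z}^{s,N}_t$ denotes the $E^s$-valued process formed by the first $s$ components of $\mathcal{Z}^N_t$. Moreover $(f_t)_t$ is a weak measure solution, with initial condition $f_0$, of the general Boltzmann equation: for all $\varphi\in C_b(E)$, $$\frac{\mathrm{d}}{\mathrm{d}t}\langle f_t,\varphi\rangle=\int_{E^3}\lambda(z_1,z_2)\{\varphi(z_1')-\varphi(z_1)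\}\,\Gamma^{(2)}(z_1,z_2,\mathrm{d}z_1',E)\,f_t(\mathrm{d}z_1)f_t(\mathrm{d}z_2).$$
   Context: Assumptions on $L^{(2)}$: $L^{(2)}$ acts on $C_b(E^2)$ (it maps $C_b(E^2)$ into itself); the post-collisional distribution $\Gamma^{(2)}:E\times E\to\mathcal{P}(E\times E)$ is continuous and symmetric in the sense that $\Gamma^{(2)}(z_1,z_2,\mathrm{d}z_1',\mathrm{d}z_2')=\Gamma^{(2)}(z_2,z_1,\mathrm{d}z_2',\mathrm{d}z_1')$; the collision rate $\lambda:E\times E\to\mathbb{R}_+$ is symmetric, measurable on $\{z_1\neq z_2\}$, and $\lambda(z,z)=0$ for all $z\in E$. For $i<j$, $L^{(2)}\diamond_{ij}\varphi_N(z^1,\ldots,z^N)=L^{(2)}\big[(u,v)\mapsto\varphi_N(z^1,\ldots,z^{i-1},u,z^{i+1},\ldots,z^{j-1},v,z^{j+1},\ldots,z^N)\big](z^i,z^j)$. $\langle\mu,\varphi\rangle=\int\varphi\,\mathrm{d}\mu$. A sequence of symmetric $f^N\in\mathcal{P}(E^N)$ is $f$-chaotic if for every $k\geq1$ its $k$-th marginal converges weakly (against $C_b(E^k)$) to $f^{\otimes k}$ as $N\to\infty$. *)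

(* Defs.v *)
From HB Require Import structures.
From mathcomp Require Import all_boot all_order all_algebra.
From mathcomp Require Import perm.
From mathcomp Require Import all_classical all_reals all_analysis.
Set Implicit Arguments.
Unset Strict Implicit.
Unset Printing Implicit Defensive.
Import Order.TTheory GRing.Theory Num.Theory.
Import numFieldNormedType.Exports.
Local Open Scope classical_set_scope.
Local Open Scope ring_scope.

(* A Polish space is given together with a compatible complete metric: a
   completePseudoMetricType that is Hausdorff, so that the pseudometric is a
   metric, and separable. *)
Definition polish_space (T : topologicalType) : Prop :=
  hausdorff_space T /\ exists2 D : set T, countable D & dense D.

(* E with its Borel sigma-algebra. Products borel E * borel E and
   N.-tuple (borel E) carry the product sigma-algebra, which is the Borel
   sigma-algebra of the product topology since E is second countable. *)
Notation borel E := (g_sigma_algebraType (@open E)).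

(* The product topology on E^n. *)
HB.instance Definition _ (T : topologicalType) (n : nat) :=
  Topological.copy (n.-tuple T)
    (initial_topology (fun z : n.-tuple T =>
      (fun i => tnth z i) : prod_topology (fun _ : 'I_n => T))).

Definition Cb (R : realType) (T : topologicalType) : set (T -> R) :=
  [set phi | continuous phi /\ bounded_fun phi].
Arguments Cb : clear implicits.

Section product_probability.
Context d1 d2 (T1 : measurableType d1) (T2 : measurableType d2) (R : realType).
Variables (P1 : probability T1 R) (P2 : probability T2 R).

Let prod := (P1 \x P2)%E.

HB.instance Definition _ := Measure.on prod.

Let prod_setT : prod setT = 1%E.
Proof.
rewrite -setXTT [LHS]product_measure1E// -[RHS]mule1.
by congr (_ * _)%E; exact: probability_setT.
Qed.

HB.instance Definition _ := Measure_isProbability.Build _ _ _ prod prod_setT.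

Definition product_probability : probability (T1 * T2)%type R := prod.

End product_probability.

Section tuple_maps.
Context d (T : measurableType d).

Definition tuple_cons n (p : T * n.-tuple T) : n.+1.-tuple T :=
  [tuple of p.1 :: p.2].

Lemma measurable_tuple_cons n : measurable_fun setT (@tuple_cons n).
Proof. exact: measurable_cons. Qed.

HB.instance Definition _ n :=
  isMeasurableFun.Build _ _ _ _ (@tuple_cons n) (@measurable_tuple_cons n).

Definition first k n (z : (k + n).-tuple T) : k.-tuple T :=
  [tuple tnth z (lshift n i) | i < k].

Lemma measurable_first k n : measurable_fun setT (@first k n).
Proof.
apply/measurable_fun_tnthP => i.
rewrite [X in measurable_fun _ X](_ : _ = (@tnth _ T)^~ (lshift n i)).
  exact: measurable_tnth.
by apply/funext => z /=; rewrite tnth_mktuple.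
Qed.

HB.instance Definition _ k n :=
  isMeasurableFun.Build _ _ _ _ (@first k n) (@measurable_first k n).

End tuple_maps.

HB.instance Definition _ d1 d2 (T1 : measurableType d1)
    (T2 : measurableType d2) :=
  isMeasurableFun.Build _ _ _ _ (@fst T1 T2) measurable_fst.

Section laws.
Context d (T : measurableType d) (R : realType).

Fixpoint tensor_power (mu : probability T R) k : probability (k.-tuple T) R :=
  if k is k'.+1
  then distribution (product_probability mu (tensor_power mu k'))
         (@tuple_cons _ T k')
  else dirac [tuple].

Definition symmetric_law N (mu : probability (N.-tuple T) R) : Prop :=
  forall (s : 'S_N) (A : set (N.-tuple T)), measurable A ->
    mu [set z | A [tuple tnth z (s i) | i < N]] = mu A.

End laws.

(* Since the k-th marginal of a law on E^N only makes sense for N >= k, the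
   limit N -> oo is written with N = k + n and n -> oo. *)
Definition chaotic (R : realType) (E : ptopologicalType)
    (f : probability (borel E) R)
    (fN : forall N, probability (N.-tuple (borel E)) R) : Prop :=
  forall k, (0 < k)%N -> forall phi, Cb R (k.-tuple E) phi ->
    \int[distribution (fN (k + n)%N) (@first _ (borel E) k n)]_z phi z
      @[n --> \oo] --> \int[tensor_power f k]_z phi z.

Section collisions.
Context (R : realType) (E : ptopologicalType).
Variables (lam : E * E -> R)
          (Gam : E * E -> probability (borel E * borel E)%type R).

Definition L2 (phi : E * E -> R) (z : E * E) : R :=
  lam z * \int[Gam z]_z' (phi z' - phi z).

(* Gam is continuous for the weak topology of the probability measures. *)
Definition post_collisional : Prop :=
  (forall phi, Cb R (E * E)%type phi ->
     continuous (fun z : E * E => \int[Gam z]_z' phi z')) /\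
  (forall (z1 z2 : E) (A : set (borel E * borel E)), measurable A ->
     Gam (z1, z2) A = Gam (z2, z1) [set p | A (p.2, p.1)]).

Definition collision_rate : Prop :=
  [/\ forall z, 0 <= lam z,
      forall z1 z2, lam (z1, z2) = lam (z2, z1),
      measurable_fun [set z : borel E * borel E | z.1 <> z.2] lam &
      forall z, lam (z, z) = 0].

Definition subst2 N (z : N.-tuple E) (i j : 'I_N) (u v : E) : N.-tuple E :=
  [tuple if k == i then u else if k == j then v else tnth z k | k < N].

Definition diamond N (i j : 'I_N) (phi : N.-tuple E -> R) (z : N.-tuple E) : R :=
  L2 (fun p => phi (subst2 z i j p.1 p.2)) (tnth z i, tnth z j).

Definition particle_generator N (phi : N.-tuple E -> R) (z : N.-tuple E) : R :=
  N%:R^-1 * \sum_(i < N) \sum_(j < N | (i < j)%N) diamond i j phi z.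

(* Gam z (dz1', E) is the image of Gam z under the first projection. *)
Definition boltzmann_rhs (f : probability (borel E) R) (phi : E -> R) : R :=
  \int[product_probability f f]_z
    (lam z * \int[distribution (Gam z) (@fst (borel E) (borel E))]_z'
               (phi z' - phi z.1)).

(* The equation is required at every t >= 0, with the right derivative at
   t = 0; in particular t |-> <f_t, phi> is continuous at 0. *)
Definition weak_boltzmann_solution (f0 : probability (borel E) R)
    (f : R -> probability (borel E) R) : Prop :=
  f 0 = f0 /\
  forall phi, Cb R E phi ->
    (forall t : R, 0 < t ->
       is_derive t 1 (fun u => \int[f u]_z phi z) (boltzmann_rhs (f t) phi)) /\
    h^-1 * (\int[f h]_z phi z - \int[f 0]_z phi z) @[h --> 0^'+]
      --> boltzmann_rhs (f 0) phi.

End collisions.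

Section markov.
Context (R : realType) d (Omega : measurableType d) (P : probability Omega R).
Context d' (S : measurableType d').

(* Only the variables Z t with 0 <= t are used. *)
Definition natural_filtration (Z : R -> {RV P >-> S}) (t : R) :
    set (set Omega) :=
  <<s [set A | exists u B, [/\ 0 <= u <= t, measurable B & A = Z u @^-1` B]] >>.

Definition transition_semigroup (K : R -> R.-pker S ~> S) : Prop :=
  (forall x A, measurable A -> K 0 x A = \d_x A) /\
  (forall s t x A, 0 <= s -> 0 <= t -> measurable A ->
     K (s + t) x A = (\int[K s x]_y K t y A)%E).

Definition markov_process (K : R -> R.-pker S ~> S) (Z : R -> {RV P >-> S}) :
    Prop :=
  forall s h A B, 0 <= s -> 0 <= h -> natural_filtration Z s A ->
    measurable B ->
    P (A `&` Z (s + h) @^-1` B) = (\int[P]_(w in A) K h (Z s w) B)%E.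

End markov.

(* Z is a time-homogeneous Markov process on E^N whose transition semigroup
   has the generator L on Cb(E^N), for the supremum norm. *)
Definition markov_with_generator (R : realType) d (Omega : measurableType d)
    (P : probability Omega R) (E : ptopologicalType) N
    (Z : R -> {RV P >-> N.-tuple (borel E)})
    (L : (N.-tuple E -> R) -> N.-tuple E -> R) : Prop :=
  exists K : R -> R.-pker N.-tuple (borel E) ~> N.-tuple (borel E),
    [/\ transition_semigroup K,
        markov_process K Z &
        forall phi, Cb R (N.-tuple E) phi ->
          {uniform, (fun h x => h^-1 * (\int[K h x]_y phi y - phi x))
                      @ 0^'+ --> L phi}].

(* Main.v *)
(* The limit f_t is Wild's sum of collision trees for the rate M = Lam + 1,
     f_t = sum_n e^(-Mt) (1 - e^(-Mt))^n Q_n,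
     Q_0 = f_0,  Q_(n+1) = (1/(n+1)) sum_(k <= n) Q_k o Q_(n-k),
   where mu o nu is the law of the first particle after a collision of
   independent particles of laws mu and nu, in which fictitious collisions raise
   the rate to the constant M. Differentiating the product of the generating
   series gives the Boltzmann equation for all bounded measurable test functions.

   Chaos is propagated through the BBGKY hierarchy. If D phi denotes the function
   of k+1 particles obtained by letting each of the k particles of phi collide with
   the additional one, then d/dt <f_t^(k), phi> = <f_t^(k+1), D phi>, while for k
   distinct particles of the N-particle process the derivative of E[phi] is the
   average over the other particles j of E[D phi] (with j added), up to O(k^2 / N).
   Since D phi is bounded by 2 k M |phi|, n iterations over a time u bound the
   difference by o(1) + 2 |phi| C(k+n, n) (2Mu)^n, which is small for u <= 1/(8M);
   iterating in time reaches every t. Exchangeability is used at t = 0 only, where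
   it extends chaos from the first k particles to any k distinct ones. *)

From HB Require Import structures.
Require Import Defs.
From mathcomp Require Import all_boot all_order all_algebra.
From mathcomp Require Import perm ring lra.
From mathcomp Require Import all_classical all_reals all_analysis.
From mathcomp Require Import measurable_realfun.
Set Implicit Arguments.
Unset Strict Implicit.
Unset Printing Implicit Defensive.
Import Order.TTheory GRing.Theory Num.Theory.
Import numFieldNormedType.Exports.
Local Open Scope classical_set_scope.
Local Open Scope ring_scope.

(** * Means of bounded measurable functions *)

(** Two classes of test functions are kept apart. The generator of the particle process is known on
    bounded continuous functions only, so every iterate of D must stay continuous, although [lam] is
    merely measurable and [hL2] concerns one fixed function of two variables. Here the other
    particles are parameters that move the test function as well, and the missing uniformity comes
    from a tightness argument based on the weak continuity of [Gam]. The limit flow is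
    differentiated against all bounded measurable functions instead: its tensor powers are handled
    by integrating out some of the variables, and then only bounds have to be tracked. In time,
    nothing is assumed on the paths of the particle process. A generator limit uniform in the
    starting point and time homogeneity give right derivatives whose remainder is uniform in t,
    which suffices to integrate inequalities along a subdivision. *)

Section bounded_measurable.
Context d (T : measurableType d) (R : realType).

(** The bound is an explicit parameter because its growth under the hierarchy is what the final
    estimate counts. *)
Definition bounded_mfun (B : R) (f : T -> R) :=
  measurable_fun setT f /\ forall x, `|f x| <= B.

Lemma bounded_mfun_ge0 B f (x : T) : bounded_mfun B f -> 0 <= B.
Proof. by move=> [_ /(_ x)]; apply: le_trans. Qed.

Lemma bounded_mfunW B C f : B <= C -> bounded_mfun B f -> bounded_mfun C f.
Proof. by move=> BC [mf fB]; split=> // x; apply: le_trans BC. Qed.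

Lemma bounded_mfunD B C f g : bounded_mfun B f -> bounded_mfun C g ->
  bounded_mfun (B + C) (fun x => f x + g x).
Proof.
move=> [mf fB] [mg gC]; split; first exact: measurable_funD.
by move=> x; rewrite (le_trans (ler_normD _ _))// lerD.
Qed.

Lemma bounded_mfunB B C f g : bounded_mfun B f -> bounded_mfun C g ->
  bounded_mfun (B + C) (fun x => f x - g x).
Proof.
move=> [mf fB] [mg gC]; split; first exact: measurable_funB.
by move=> x; rewrite (le_trans (ler_normB _ _))// lerD.
Qed.

Lemma bounded_mfunM B C f g : bounded_mfun B f -> bounded_mfun C g ->
  bounded_mfun (B * C) (fun x => f x * g x).
Proof.
move=> [mf fB] [mg gC]; split; first exact: measurable_funM.
by move=> x; rewrite normrM ler_pM.
Qed.

Lemma bounded_mfun_cst (c : R) : bounded_mfun `|c| (fun=> c).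
Proof. by split. Qed.

Lemma bounded_mfunZ c B f : bounded_mfun B f ->
  bounded_mfun (`|c| * B) (fun x => c * f x).
Proof. by move=> fB; apply: bounded_mfunM fB; exact: bounded_mfun_cst. Qed.

Lemma bounded_mfun_sum (I : Type) (s : seq I) (P : pred I) B
    (f : I -> T -> R) : (forall i, bounded_mfun B (f i)) ->
  bounded_mfun (\sum_(i <- s | P i) B) (fun x => \sum_(i <- s | P i) f i x).
Proof.
move=> fB; split.
  elim: s => [|i s ih].
    rewrite [X in measurable_fun _ X](_ : _ = cst 0)//.
    by apply/funext => x; rewrite big_nil.
  rewrite [X in measurable_fun _ X](_ : _ =
    fun x => if P i then f i x + \sum_(j <- s | P j) f j x
             else \sum_(j <- s | P j) f j x); last first.
    by apply/funext => x; rewrite big_cons.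
  by case: (P i) => //; apply: measurable_funD => //; have [] := fB i.
move=> x; apply: (le_trans (ler_norm_sum _ _ _)).
by apply: ler_sum => i _; have [] := fB i.
Qed.

End bounded_measurable.

Lemma bounded_mfun_comp d d' (S : measurableType d) (T : measurableType d')
    (R : realType) (B : R) (f : T -> R) (g : S -> T) :
  measurable_fun setT g -> bounded_mfun B f -> bounded_mfun B (f \o g).
Proof. by move=> mg [mf fB]; split=> [|x]; [exact: measurableT_comp|exact: fB]. Qed.

Section mean.
Context d (T : measurableType d) (R : realType).
Variable mu : {measure set T -> \bar R}.
Hypothesis mu1 : mu setT = 1%E.
Implicit Types (B C : R) (f g : T -> R).

Lemma bounded_integrable B f : bounded_mfun B f ->
  mu.-integrable setT (EFin \o f).
Proof.
move=> [mf fB]; apply: measurable_bounded_integrable => //.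
  by rewrite mu1 ltry.
exists B; split; first exact: num_real.
by move=> M BM x _; apply: le_trans (fB x) (ltW BM).
Qed.

Lemma EFin_mean B f : bounded_mfun B f ->
  (\int[mu]_x f x)%:E = (\int[mu]_x (f x)%:E)%E.
Proof.
by move=> /bounded_integrable fB; rewrite fineK//; exact: integrable_fin_num.
Qed.

Lemma mean_cst (c : R) : \int[mu]_x (fun=> c) x = c.
Proof. by rewrite Rintegral_cst// mu1 mulr1. Qed.

Lemma meanD B C f g : bounded_mfun B f -> bounded_mfun C g ->
  \int[mu]_x (f x + g x) = \int[mu]_x f x + \int[mu]_x g x.
Proof. by move=> /bounded_integrable ? /bounded_integrable ?; rewrite RintegralD. Qed.

Lemma meanB B C f g : bounded_mfun B f -> bounded_mfun C g ->
  \int[mu]_x (f x - g x) = \int[mu]_x f x - \int[mu]_x g x.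
Proof. by move=> /bounded_integrable ? /bounded_integrable ?; rewrite RintegralB. Qed.

Lemma meanZ c B f : bounded_mfun B f ->
  \int[mu]_x (c * f x) = c * \int[mu]_x f x.
Proof. by move=> /bounded_integrable ?; rewrite RintegralZl. Qed.

Lemma le_mean B C f g : bounded_mfun B f -> bounded_mfun C g ->
  (forall x, f x <= g x) -> \int[mu]_x f x <= \int[mu]_x g x.
Proof.
by move=> /bounded_integrable ? /bounded_integrable ? fg; exact: le_Rintegral.
Qed.

Lemma norm_mean B f : bounded_mfun B f -> `|\int[mu]_x f x| <= B.
Proof.
move=> fB; apply: (le_trans (le_normr_Rintegral _ _)) => //.
  exact: bounded_integrable fB.
rewrite -[leRHS](mean_cst B); have [mf lefB] := fB.
apply: (@le_mean B `|B|) => //.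
  split; first exact: measurableT_comp.
  by move=> x; rewrite normr_id.
Qed.

Lemma mean_sum (I : Type) (s : seq I) (P : pred I) B (f : I -> T -> R) :
  (forall i, bounded_mfun B (f i)) ->
  \int[mu]_x (\sum_(i <- s | P i) f i x) = \sum_(i <- s | P i) \int[mu]_x f i x.
Proof.
move=> fB; elim: s => [|i s ih].
  rewrite big_nil -[RHS](mean_cst 0); apply: eq_Rintegral => x _.
  by rewrite big_nil.
rewrite big_cons; case: ifPn => Pi; last first.
  by rewrite -ih; apply: eq_Rintegral => x _; rewrite big_cons (negbTE Pi).
rewrite -ih -(@meanD B _ _ _ (fB i) (bounded_mfun_sum s P fB)).
by apply: eq_Rintegral => x _; rewrite big_cons Pi.
Qed.

Lemma bounded_mfun_lim B (f_ : nat -> T -> R) f :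
  (forall n, bounded_mfun B (f_ n)) -> (forall x, f_ n x @[n --> \oo] --> f x) ->
  bounded_mfun B f.
Proof.
move=> fB ff; split.
  by apply: (@measurable_fun_cvg _ _ _ setT f_) => [n|x _]; [exact: (fB n).1|exact: ff].
move=> x; have cfx : `|f_ n x| @[n --> \oo] --> `|f x| by exact: cvg_norm (ff x).
rewrite -(cvg_lim (@norm_hausdorff _ _) cfx).
apply: limr_le; first by apply/cvg_ex; eexists; exact: cfx.
by apply: nearW => n; exact: (fB n).2.
Qed.

Lemma mean_dominated_cvg B (f_ : nat -> T -> R) f :
  (forall n, bounded_mfun B (f_ n)) -> (forall x, f_ n x @[n --> \oo] --> f x) ->
  \int[mu]_x f_ n x @[n --> \oo] --> \int[mu]_x f x.
Proof.
move=> fB ff; have lfB := bounded_mfun_lim fB ff.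
apply: fine_cvg; rewrite -/(Rintegral _ _ _) (EFin_mean lfB).
have [] // := @dominated_convergence _ T R mu setT measurableT
  (fun n => EFin \o f_ n) (EFin \o f) (cst B%:E).
- by move=> n; apply/measurable_EFinP; exact: (fB n).1.
- by apply/measurable_EFinP; exact: lfB.1.
- by apply: aeW => x _; apply/fine_cvgP; split; [exact: nearW|exact: ff].
- exact: (bounded_integrable (bounded_mfun_cst T B)).
- by apply: aeW => x n _ /=; rewrite lee_fin; exact: (fB n).2.
Qed.

End mean.

Section mean_maps.
Context d d' (S : measurableType d) (T : measurableType d') (R : realType).

Lemma mean_pushforward (P : probability S R) (X : {mfun S >-> T}) B (f : T -> R) :
  bounded_mfun B f ->
  \int[distribution P X]_y f y = \int[P]_x f (X x).
Proof.
move=> fB; congr fine; rewrite integral_distribution//.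
  by apply/measurable_EFinP; exact: fB.1.
apply: (@bounded_integrable _ _ _ P (probability_setT P) B (f \o X)).
exact: bounded_mfun_comp fB.
Qed.

Lemma bounded_mfun_mean (k : R.-pker S ~> T) B (f : S * T -> R) :
  bounded_mfun B f -> bounded_mfun B (fun x => \int[k x]_y f (x, y)).
Proof.
move=> fB; have kx x : k x setT = 1%E by exact: prob_kernel.
have fxB x : bounded_mfun B (fun y => f (x, y)).
  by apply: bounded_mfun_comp fB; exact: pair1_measurable.
split; last by move=> x; exact: (norm_mean (kx x) (fxB x)).
(* Measurability of the integral against a kernel is obtained for the nonnegative function [f + B];
   the mean of the constant is then subtracted. *)
rewrite [X in measurable_fun _ X](_ : _ =
    (fun x => fine (\int[k x]_y (f (x, y) + B)%:E)%E - B)).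
  apply: measurable_funB => //; apply: measurableT_comp => //.
  apply: (measurable_fun_integral_finite_kernel (fun z => (f z + B)%:E)).
    move=> z; rewrite lee_fin -lerBlDr sub0r.
    by have := fB.2 z; rewrite ler_norml => /andP[].
  by apply/measurable_EFinP; apply: measurable_funD => //; exact: fB.1.
apply/funext => x; rewrite -[fine _]/(\int[k x]_y (f (x, y) + B)).
by rewrite (meanD (kx x) (fxB x) (bounded_mfun_cst T B)) (mean_cst (kx x)) addrK.
Qed.

End mean_maps.

Section mean_product.
Context d1 d2 (T1 : measurableType d1) (T2 : measurableType d2) (R : realType).
Variables (P1 : probability T1 R) (P2 : probability T2 R).
Variables (B : R) (f : T1 * T2 -> R).
Hypothesis fB : bounded_mfun B f.

Let prod1 := @probability_setT _ _ _ (product_probability P1 P2).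

Lemma mean_product12 :
  \int[product_probability P1 P2]_z f z = \int[P1]_x \int[P2]_y f (x, y).
Proof.
rewrite /Rintegral; congr fine.
rewrite -(@integral12_prod_meas1 _ _ _ _ _ P1 P2 (EFin \o f)).
  apply: eq_integral => x _; rewrite fineK//.
  apply: integrable_fin_num => //.
  apply: (@bounded_integrable _ _ _ P2 (probability_setT P2) B).
  by apply: bounded_mfun_comp fB; exact: pair1_measurable.
exact: (bounded_integrable prod1 fB).
Qed.

Lemma mean_product21 :
  \int[product_probability P1 P2]_z f z = \int[P2]_y \int[P1]_x f (x, y).
Proof.
rewrite /Rintegral; congr fine.
rewrite -(@integral21_prod_meas1 _ _ _ _ _ P1 P2 (EFin \o f)).
  apply: eq_integral => x _; rewrite fineK//.
  apply: integrable_fin_num => //.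
  apply: (@bounded_integrable _ _ _ P1 (probability_setT P1) B).
  by apply: bounded_mfun_comp fB; exact: pair2_measurable.
exact: (bounded_integrable prod1 fB).
Qed.

End mean_product.

(** * Product topology and Borel sets of a Polish space *)

Section tuple_topology.
Variable T : topologicalType.

Lemma cvg_tuple n (X : Type) (F : set_system X) (FF : Filter F)
    (g : X -> n.-tuple T) (z : n.-tuple T) :
  (forall i, tnth (g x) i @[x --> F] --> tnth z i) -> g x @[x --> F] --> z.
Proof.
move=> gz A /= [_ [[B Bop <-] Bz sBA]].
pose h (w : n.-tuple T) : prod_topology (fun _ : 'I_n => T) := tnth w.
have hF : (h \o g) @ F --> h z.
  apply/cvg_sup => i C /= [_ [[D Dop <-] Dz sDC]].
  apply: (filterS sDC); apply: gz.
  exact: open_nbhs_nbhs.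
apply: (filterS sBA); apply: (hF B).
exact: open_nbhs_nbhs.
Qed.

Lemma tnth_continuous n (i : 'I_n) :
  continuous (fun z : n.-tuple T => tnth z i).
Proof.
move=> z A Aiz.
pose h (w : n.-tuple T) : prod_topology (fun _ : 'I_n => T) := tnth w.
have hc : continuous h.
  exact: (@initial_continuous (n.-tuple T) (prod_topology (fun=> T)) h).
have pc := @proj_continuous 'I_n (fun=> T) i.
exact: (hc z _ (pc (h z) A Aiz)).
Qed.

Lemma continuous_tuple (X : topologicalType) n (g : X -> n.-tuple T) :
  (forall i, continuous (fun x => tnth (g x) i)) -> continuous g.
Proof. by move=> gc x; apply: cvg_tuple => i; exact: gc. Qed.

End tuple_topology.

Section tuple_pseudometric.
Context (R : realType) (T : pseudoMetricType R).

Definition tuple_ball n (z : n.-tuple T) (e : R) : set (n.-tuple T) :=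
  [set w | forall i, ball (tnth z i) e (tnth w i)].

Lemma nbhs_tuple_ball n (z : n.-tuple T) (A : set (n.-tuple T)) :
  nbhs z A <-> exists2 e, 0 < e & tuple_ball z e `<=` A.
Proof.
split=> [zA|[e e0 zeA]]; last first.
  apply: (filterS zeA).
  apply: (filter_forall (F := nbhs z)) => i; apply: (@tnth_continuous T n i z).
  exact: nbhsx_ballx.
(* Each coordinate converges to that of [z] along the filter [F] of box neighbourhoods, so
   [cvg_tuple] applied to the identity puts every neighbourhood of [z] in [F]. *)
pose F : set_system (n.-tuple T) :=
  [set A | exists2 e, 0 < e & tuple_ball z e `<=` A].
have FF : Filter F.
  split; first by exists 1.
  - move=> P Q [e e0 eP] [e' e'0 eQ]; exists (Num.min e e').
      by rewrite lt_min e0 e'0.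
    move=> w zw; split; [apply: eP|apply: eQ] => i; apply: le_ball (zw i).
      by rewrite ge_min lexx.
    by rewrite ge_min lexx orbT.
  - by move=> P Q PQ [e e0 eP]; exists e => //; apply: subset_trans PQ.
apply: (cvg_tuple FF (g := id)) zA => i B /nbhs_ballP[e /= e0 eB].
by exists e => // w zw; apply: eB; exact: zw.
Qed.

End tuple_pseudometric.

(** Used with [g] the identity from a space with its product sigma-algebra to the same space with
    its product topology; the hypothesis then compares the two structures. *)
Lemma continuous_comp_measurable d (S : measurableType d) (X : topologicalType)
    (R : realType) (g : S -> X) (phi : X -> R) :
  (forall O, open O -> measurable (g @^-1` O)) -> continuous phi ->
  measurable_fun setT (phi \o g).
Proof.
move=> mg /continuousP cphi.
apply: (measurability _ (RGenOpens.measurableE R)).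
move=> _ [_ [a [b ->] <-]]; rewrite setTI comp_preimage; apply: mg.
exact/cphi/interval_open.
Qed.

Section polish.
Context (R : realType) (E : completePseudoMetricType R).
Hypothesis hE : polish_space E.

Lemma polish_dense_sequence :
  exists e : nat -> E, forall x r, 0 < r -> exists n, ball x r (e n).
Proof.
have [_ [D /countable_injP[f finj] Dd]] := hE.
have /choice[e eP] n : exists x, forall y, D y -> f y = n -> x = y.
  have [[y [Dy fy]]|noy] := pselect (exists y, D y /\ f y = n).
    by exists y => z Dz fz; apply: finj; rewrite ?inE// fy.
  by exists point => y Dy fy; case: noy; exists y.
exists e => x r r0.
have [y [yx Dy]] : (ball x r)° `&` D !=set0.
  apply: Dd; last exact: open_interior.
  by exists x; exact: nbhsx_ballx.
by exists (f y); rewrite (eP _ _ Dy erefl); exact: interior_subset yx.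
Qed.

Lemma small_inv_nat (e : R) : 0 < e -> exists k : nat, k.+1%:R^-1 < e.
Proof.
move=> e0; have [N _ HN] := near_infty_natSinv_lt (PosNum e0).
by exists N; exact: (HN N (leqnn _)).
Qed.

Let halfball (x y : E) (r : R) : 0 < r -> ball x (r / 2) y -> (ball y r)° x.
Proof.
move=> r0 xy; apply/nbhs_ballP; exists (r / 2); first exact: divr_gt0.
by move=> z xz; rewrite (splitr r); apply: ball_triangle xz; exact: ball_sym.
Qed.

(** Second countability: an open set is the union of those boxes it contains that belong to a
    countable family, with centres in the dense sequence and radii 1/(k+1). Interiors are taken
    since balls need not be open. *)
Lemma open_prod_measurable (O : set (E * E)) :
  open O -> measurable (O : set (borel E * borel E)).
Proof.
move=> oO; have [e eP] := polish_dense_sequence.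
pose box (i : nat * nat * nat) : set (borel E * borel E) :=
  (ball (e i.1.1) i.2.+1%:R^-1)° `*` (ball (e i.1.2) i.2.+1%:R^-1)°.
suff -> : O = \bigcup_i (if `[< box i `<=` O >] then box i else set0).
  apply: countable_bigcupT_measurable => // i; case: asboolP => // _.
  by apply: measurableX; apply: sub_sigma_algebra; exact: open_interior.
apply/seteqP; split=> [x Ox|x [i _]]; last by case: asboolP => // iO /iO.
have /nbhs_ballP[r /= r0 rO] : nbhs x O by exact: open_nbhs_nbhs.
(* The radius is below r/2 and the centre lies within half a radius of [x], so the box stays within
   3/2 of a radius from [x], hence within r. *)
have [k kr] := small_inv_nat (divr_gt0 r0 (ltr0n R 2)).
have k0 : 0 < k.+1%:R^-1 :> R by rewrite invr_gt0.
have [n1 x1] := eP x.1 _ (divr_gt0 k0 (ltr0n R 2)).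
have [n2 x2] := eP x.2 _ (divr_gt0 k0 (ltr0n R 2)).
exists (n1, n2, k) => //; case: asboolP => [_|]; first by split; exact: halfball.
case; move=> y [y1 y2]; apply: rO.
have kk : k.+1%:R^-1 / 2 + k.+1%:R^-1 <= r.
  by move: kr k0; move: (k.+1%:R^-1) => q; lra.
split; apply: (le_ball kk).
  by apply: (ball_triangle x1); exact: interior_subset y1.
by apply: (ball_triangle x2); exact: interior_subset y2.
Qed.

Lemma open_tuple_measurable n (O : set (n.-tuple E)) :
  open O -> measurable (O : set (n.-tuple (borel E))).
Proof.
move=> oO; have [e eP] := polish_dense_sequence.
pose box (c : n.-tuple nat * nat) : set (n.-tuple (borel E)) :=
  \bigcap_(i in [set: 'I_n])
    ((@tnth _ (borel E))^~ i @^-1` (ball (e (tnth c.1 i)) c.2.+1%:R^-1)°).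
suff -> : O = \bigcup_c (if `[< box c `<=` O >] then box c else set0).
  apply: countable_bigcupT_measurable => // c; case: asboolP => // _.
  apply: fin_bigcap_measurable => // i _.
  rewrite -[X in measurable X]setTI; apply: measurable_tnth => //.
  by apply: sub_sigma_algebra; exact: open_interior.
apply/seteqP; split=> [x Ox|x [c _]]; last by case: asboolP => // cO /cO.
have /nbhs_tuple_ball[r /= r0 rO] : nbhs x O by exact: open_nbhs_nbhs.
have [k kr] := small_inv_nat (divr_gt0 r0 (ltr0n R 2)).
have k0 : 0 < k.+1%:R^-1 :> R by rewrite invr_gt0.
have /choice[m mP] : forall i, exists m, ball (tnth x i) (k.+1%:R^-1 / 2) (e m).
  by move=> i; exact: eP (divr_gt0 k0 (ltr0n R 2)).
exists ([tuple m i | i < n], k) => //; case: asboolP => [_|].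
  by move=> i _ /=; rewrite tnth_mktuple; exact: halfball.
case; move=> y yb; apply: rO => i.
have kk : k.+1%:R^-1 / 2 + k.+1%:R^-1 <= r.
  by move: kr k0; move: (k.+1%:R^-1) => q; lra.
apply: (le_ball kk); apply: (ball_triangle (mP i)).
by have := yb i I; rewrite /= tnth_mktuple => /interior_subset.
Qed.

Lemma continuous_measurable_polish (phi : E -> R) :
  continuous phi -> measurable_fun setT (phi : borel E -> R).
Proof.
apply: (@continuous_comp_measurable _ (borel E) E R idfun) => O oO.
exact: sub_sigma_algebra.
Qed.

Lemma continuous_measurable_prod (phi : E * E -> R) :
  continuous phi -> measurable_fun setT (phi : borel E * borel E -> R).
Proof.
apply: (@continuous_comp_measurable _ (borel E * borel E)%type (E * E)%type R idfun).
exact: open_prod_measurable.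
Qed.

Lemma continuous_measurable_tuple n (phi : n.-tuple E -> R) :
  continuous phi -> measurable_fun setT (phi : n.-tuple (borel E) -> R).
Proof.
apply: (@continuous_comp_measurable _ (n.-tuple (borel E)) (n.-tuple E) R idfun).
exact: open_tuple_measurable.
Qed.

End polish.

Lemma mean_indic d (T : measurableType d) (R : realType)
    (mu : {measure set T -> \bar R}) (A : set T) :
  measurable A -> \int[mu]_x (\1_A x : R) = fine (mu A).
Proof. by move=> mA; rewrite /Rintegral integral_indic// setIT. Qed.

(** * The collision kernel *)

Section kernel_of_probability.
Context d d' (X : measurableType d) (Y : measurableType d') (R : realType).
Variable P : X -> probability Y R.
Hypothesis mP : forall A, measurable A -> measurable_fun setT (fun x => P x A).

Definition kernel_of_probability of
    (forall A, measurable A -> measurable_fun setT (fun x => P x A)) :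
  X -> {measure set Y -> \bar R} := P.

HB.instance Definition _ :=
  @isKernel.Build _ _ X Y R (kernel_of_probability mP) mP.

Let kernel_of_probability1 x : kernel_of_probability mP x setT = 1%E.
Proof. exact: probability_setT. Qed.

HB.instance Definition _ := @Kernel_isProbability.Build _ _ X Y R
  (kernel_of_probability mP) kernel_of_probability1.

Lemma bounded_mfun_kernel_mean B (f : X * Y -> R) : bounded_mfun B f ->
  bounded_mfun B (fun x => \int[P x]_y f (x, y)).
Proof. exact: (bounded_mfun_mean (kernel_of_probability mP)). Qed.

End kernel_of_probability.

(** [F] and the set [B k] of points at distance at least 1/(k+1) from it are separated by an
    entourage, which provides a Urysohn function. A point outside the closed set [F] lies in [B k]
    for all large [k], so the convergence is eventually stationary. *)
Lemma closed_indicator_approx (R : realType) (X : pseudoMetricType R)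
    (F : set X) : closed F ->
  exists chi : nat -> X -> R, [/\ forall k, continuous (chi k),
    forall k x, 0 <= chi k x <= 1, forall k x, F x -> chi k x = 1 &
    forall x, chi k x @[k --> \oo] --> (\1_F x : R)].
Proof.
move=> cF.
pose B k := [set x : X | forall a, F a -> ~ ball a k.+1%:R^-1 x].
have sep k : uniform_separator F (B k).
  apply: uniform_separatorW; exists [set xy | ball xy.1 (k.+1%:R^-1 : R) xy.2].
    have k0 : 0 < k.+1%:R^-1 :> R by rewrite invr_gt0.
    exact: (entourage_ball X (PosNum k0)).
  by apply/seteqP; split=> // -[x y] [[Fx By] /= /(By _ Fx)].
pose chi k x : R := 1 - Urysohn F (B k) x.
exists chi; have chi01 k x : 0 <= chi k x <= 1.
  have /(_ (Urysohn F (B k) x)) := @Urysohn_range X R F (B k).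
  rewrite /= in_itv /= => /(_ (ex_intro2 _ _ x I erefl)) /andP[? ?].
  by rewrite /chi; apply/andP; split; lra.
have chiF k x : F x -> chi k x = 1.
  move=> Fx; rewrite /chi (_ : Urysohn _ _ x = 0) ?subr0//.
  by apply: (Urysohn_sub0 (sep k)); exists x.
split=> //.
- move=> k x; apply: cvgB; first exact: cvg_cst.
  exact: Urysohn_continuous.
- move=> x; have [Fx|nFx] := pselect (F x).
    rewrite indicE mem_set//; apply: cvg_near_cst.
    by apply: nearW => k; exact: chiF.
  rewrite indicE memNset//; apply: cvg_near_cst.
  have /nbhs_ballP[e /= e0 eF] : nbhs x (~` F).
    by apply: open_nbhs_nbhs; split => //; exact: closed_openC.
  have [N _ HN] := near_infty_natSinv_lt (PosNum e0).
  exists N => // k Nk; rewrite /chi (_ : Urysohn _ _ x = 1) ?subrr//.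
  apply: (Urysohn_sub1 (sep k)); exists x => // a Fa /ball_sym xa.
  by apply: (eF a) => //; apply: le_ball xa; exact: ltW (HN k Nk).
Qed.

Section collision_kernel.
Context (R : realType) (E : completePseudoMetricType R).
Hypothesis hE : polish_space E.

(** The closed sets are a generating family stable under intersection whose indicators are limits of
    continuous functions, as the Dynkin argument for [Gam] requires. *)
Lemma borel_prod_generated :
  @measurable _ (borel E * borel E)%type = <<s @closed (E * E)%type >>.
Proof.
apply/seteqP; split; last first.
  apply: smallest_sub => [|F cF]; first exact: sigma_algebra_measurable.
  rewrite -(setCK F); apply: measurableC; apply: open_prod_measurable => //.
  exact: closed_openC.
pose W := g_sigma_algebraType (@closed (E * E)%type).
have mO (g : E * E -> E) : continuous g -> forall A : set (borel E),
    measurable A -> measurable ((g : W -> borel E) @^-1` A).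
  move=> cg A mA; rewrite -[X in measurable X]setTI.
  have : measurable_fun setT (g : W -> borel E).
    apply: (@measurability _ _ W (borel E) setT g (@open E)) => //.
    move=> _ [U oU <-]; rewrite setTI -[X in measurable X]setCK; apply: measurableC.
    apply: sub_sigma_algebra; apply: open_closedC.
    by have /continuousP := cg; apply.
  exact.
apply: smallest_sub; first exact: smallest_sigma_algebra.
by move=> _ [[A mA <-]|[A mA <-]]; rewrite setTI; apply: mO => //;
  [move=> x; exact: cvg_fst|move=> x; exact: cvg_snd].
Qed.

Variable Gam : E * E -> probability (borel E * borel E)%type R.
Hypothesis hGam : post_collisional Gam.

(** Weak continuity makes [Gam] a kernel: for closed [A] the mass is a pointwise limit of the
    continuous means of [chi k], and Dynkin induction reaches all measurable sets. *)
Lemma post_collisional_kernel (A : set (borel E * borel E)) : measurable A ->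
  measurable_fun setT (fun z : borel E * borel E => Gam z A).
Proof.
move=> mA; have : <<s @closed (E * E)%type >> A by rewrite -borel_prod_generated.
move: A {mA}; apply: (@dynkin_induction _ (borel E * borel E)%type
  (@closed (E * E)%type)
  (fun A => measurable_fun setT (fun z : borel E * borel E => Gam z A))).
- exact: borel_prod_generated.
- exact: closedI.
- rewrite [X in measurable_fun _ X](_ : _ = cst 1%E)//.
  by apply/funext => z; rewrite probability_setT.
- move=> F cF; have [chi [cchi chi01 chiF chil]] := closed_indicator_approx cF.
  have bchi k : bounded_mfun 1 (chi k : borel E * borel E -> R).
    split; first exact: (continuous_measurable_prod hE).
    by move=> x; have /andP[c0 c1] := chi01 k x; rewrite ger0_norm.
  apply: (@emeasurable_fun_cvg _ (borel E * borel E)%type R setT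
    (fun k z => (\int[Gam z]_z' chi k z')%:E) (fun z => Gam z F)).
    move=> k; apply/measurable_EFinP; apply: continuous_measurable_prod => //.
    apply: hGam.1; split; first exact: cchi.
    exists 1; split => // M M1 x _ /=; apply: le_trans (ltW M1).
    exact: (bchi k).2.
  move=> z _; have mF : measurable (F : set (borel E * borel E)).
    by rewrite borel_prod_generated; exact: sub_sigma_algebra.
  rewrite -(@fineK _ (Gam z F)) ?fin_num_measure//.
  rewrite -mean_indic//; apply: cvg_EFin; first exact: nearW.
  exact: (mean_dominated_cvg (probability_setT (Gam z)) bchi chil).
- move=> S mS mGS.
  rewrite [X in measurable_fun _ X](_ : _ = fun z => (1 - Gam z S)%E).
    exact: emeasurable_funB.
  by apply/funext => z; rewrite probability_setC.
- move=> F mF tF mGF.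
  rewrite [X in measurable_fun _ X](_ : _ = fun z => (\sum_(i <oo) Gam z (F i))%E).
    exact: ge0_emeasurable_sum.
  by apply/funext => z; rewrite measure_semi_bigcup//; exact: bigcupT_measurable.
Qed.

End collision_kernel.

Lemma continuous_pair (X Y Z : topologicalType) (f : X -> Y) (g : X -> Z) x :
  {for x, continuous f} -> {for x, continuous g} ->
  {for x, continuous (fun x => (f x, g x))}.
Proof. move=> cf cg; exact: (cvg_pair cf cg). Qed.

(** * The collision operator on test functions that depend on a parameter *)

Section collision_operator.
Context (R : realType) (E : completePseudoMetricType R).
Hypothesis hE : polish_space E.
Variables (lam : E * E -> R)
          (Gam : E * E -> probability (borel E * borel E)%type R).
Hypothesis hlam : collision_rate lam.
Hypothesis hGam : post_collisional Gam.
Hypothesis hL2 : forall phi, Cb R (E * E)%type phi ->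
  Cb R (E * E)%type (L2 lam Gam phi).
Variable M : R.
Hypothesis M0 : 0 < M.
Hypothesis lamM : forall z, lam z <= M.

Let Gam1 z : Gam z setT = 1%E := probability_setT (Gam z).

Lemma normr_lam z : `|lam z| <= M.
Proof. by have [lam0 _ _ _] := hlam; rewrite ger0_norm. Qed.

Lemma L2E B (phi : E * E -> R) z :
  bounded_mfun B (phi : borel E * borel E -> R) ->
  L2 lam Gam phi z = lam z * (\int[Gam z]_z' phi z' - phi z).
Proof.
move=> bphi; rewrite /L2; congr (_ * _).
by rewrite (meanB (Gam1 z) bphi (bounded_mfun_cst _ (phi z))) (mean_cst (Gam1 z)).
Qed.

Lemma norm_L2 B (phi : E * E -> R) z :
  bounded_mfun B (phi : borel E * borel E -> R) ->
  `|L2 lam Gam phi z| <= M * (2 * B).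
Proof.
move=> bphi; rewrite (L2E _ bphi) normrM ler_pM// ?normr_lam//.
rewrite mulr2n mulrDl mul1r (le_trans (ler_normB _ _))// lerD//; last exact: bphi.2.
exact: (norm_mean (Gam1 z) bphi).
Qed.

Lemma CbP (X : topologicalType) (phi : X -> R) :
  Cb R X phi <-> continuous phi /\ exists B : R, forall x, `|phi x| <= B.
Proof.
split=> -[cphi]; last first.
  move=> [B phiB]; split=> //; exists B; split; first exact: num_real.
  by move=> C BC x _ /=; exact: le_trans (phiB x) (ltW BC).
move=> [B [_ phiB]]; split=> //; exists (B + 1) => x.
by apply: phiB => //; rewrite ltrDl.
Qed.

Section joint_continuity.
Variables (n : nat) (G : n.-tuple E -> E * E -> R) (a : n.-tuple E -> E * E).
Variable B : R.
Hypothesis cG : continuous (fun p : n.-tuple E * (E * E) => G p.1 p.2).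
Hypothesis GB : forall x u, `|G x u| <= B.
Hypothesis ca : continuous a.

Let cGx x : continuous (G x).
Proof.
move=> u; apply: (continuous_comp (f := fun u => (x, u))
  (g := fun p : n.-tuple E * (E * E) => G p.1 p.2)); last exact: cG.
by apply: continuous_pair; [exact: cvg_cst|exact: cvg_id].
Qed.

Let bGx x : bounded_mfun B (G x : borel E * borel E -> R).
Proof. by split; [exact: continuous_measurable_prod|exact: GB]. Qed.

Let cGB x0 : continuous (fun p : n.-tuple E * (E * E) => G p.1 p.2 - G x0 p.2).
Proof.
move=> p; apply: cvgB; first exact: cG.
apply: (continuous_comp (f := snd) (g := G x0)); first exact: cvg_snd.
exact: cGx.
Qed.

(* The closed sets F k of the points around which G w u varies by at least e when w
   ranges over the ball of radius 1/(k+1) decrease to the empty set, so one of them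
   has small mass for Gam (a x0), hence for Gam (a x) when x is close to x0. *)
Let tight (x0 : n.-tuple E) (e : R) : 0 < e -> \forall x \near x0,
  `|\int[Gam (a x)]_u (G x u - G x0 u)| <= e + 2 * B * e.
Proof.
move=> e0.
pose V k := tuple_ball x0 (k.+1%:R^-1 : R).
pose S k := [set u | exists2 w, V k w & e <= `|G w u - G x0 u|].
pose F k : set (borel E * borel E) := closure (S k).
have mF k : measurable (F k).
  rewrite (borel_prod_generated hE); apply: sub_sigma_algebra.
  exact: closed_closure.
have ltk k : 0 < k.+1%:R^-1 :> R by rewrite invr_gt0.
have F0 : \bigcap_k F k = set0.
  apply/seteqP; split=> // u Fu.
  have : \forall p \near (x0, u), `|G p.1 p.2 - G x0 p.2| < e.
    have := @cGB x0 (x0, u); rewrite /continuous_at /= subrr => /cvgr0_norm_lt.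
    exact.
  case=> -[P Q] /= [/nbhs_tuple_ball[r r0 rP] uQ] PQe.
  have [k kr] := small_inv_nat r0.
  have [v [[w Vw ewv] Qv]] := Fu k I _ uQ.
  have /PQe : (P `*` Q) (w, v).
    by split=> //=; apply: rP => i; apply: le_ball (Vw i); exact: ltW.
  by rewrite /= ltNge ewv.
have ndF : nonincreasing_seq F.
  move=> k l kl; apply/subsetPset; apply: closure_subset => u [w Vw ew].
  exists w => // i; apply: le_ball (Vw i).
  by rewrite lef_pV2 ?posrE ?ler_nat ?ltnS.
have cF : Gam (a x0) (F k) @[k --> \oo] --> (0 : \bar R)%E.
  rewrite -(measure0 (Gam (a x0))) -F0.
  apply: nonincreasing_cvg_mu => //; last by rewrite F0.
  by rewrite (le_lt_trans (probability_le1 _ _)) ?ltry.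
have [k kF] : exists k, fine (Gam (a x0) (F k)) < e.
  have /fine_cvgP[_ /cvgr_lt /(_ _ e0) [k _ kF]] := cF.
  by exists k; exact: kF (leqnn k).
(* The mass of [F k] need not be continuous in [x], but the mean of a continuous [chi l] above its
   indicator is, so smallness at [x0] passes to nearby [x]. *)
have [chi [cchi chi01 chiF chil]] :=
  closed_indicator_approx (@closed_closure _ (S k)).
have bchi l : bounded_mfun 1 (chi l : borel E * borel E -> R).
  split; first exact: (continuous_measurable_prod hE).
  by move=> x; have /andP[c0 c1] := chi01 l x; rewrite ger0_norm.
have [l lchi] : exists l, \int[Gam (a x0)]_u chi l u < e.
  have := mean_dominated_cvg (Gam1 (a x0)) bchi chil.
  rewrite (mean_indic _ (mF k)) => /cvgr_lt /(_ _ kF)[l _ lP].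
  by exists l; exact: lP (leqnn l).
have nchi : \forall x \near x0, \int[Gam (a x)]_u chi l u < e.
  have cmean : continuous (fun z => \int[Gam z]_u chi l u).
    apply: hGam.1; apply/CbP; split; first exact: cchi.
    by exists 1; exact: (bchi l).2.
  have : \int[Gam (a x)]_u chi l u @[x --> x0] --> \int[Gam (a x0)]_u chi l u.
    exact: (cvg_comp _ _ (@ca x0) (cmean (a x0))).
  by move=> /cvgr_lt /(_ _ lchi).
have nV : \forall x \near x0, V k x by apply/nbhs_tuple_ball; exists (k.+1%:R^-1).
near=> x.
have Vx : V k x by near: x.
have chix : \int[Gam (a x)]_u chi l u < e by near: x.
have B0 : 0 <= B by exact: le_trans (normr_ge0 _) (GB x0 (a x0)).
have bG := bounded_mfunB (bGx x) (bGx x0).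
have bnG : bounded_mfun (B + B) (fun u : borel E * borel E => `|G x u - G x0 u|).
  split; first exact: measurableT_comp bG.1.
  by move=> u; rewrite normr_id; exact: bG.2.
have bc := bounded_mfunZ (2 * B) (bchi l).
have be := bounded_mfun_cst (borel E * borel E)%type e.
apply: le_trans (_ : \int[Gam (a x)]_u (e + 2 * B * chi l u) <= _); last first.
  rewrite (meanD (Gam1 (a x)) be bc) (mean_cst (Gam1 (a x))) lerD2l.
  rewrite (meanZ (Gam1 (a x)) _ (bchi l)) ler_wpM2l ?mulr_ge0//; exact: ltW.
apply: le_trans (le_normr_Rintegral _ _) _ => //.
  exact: (bounded_integrable (Gam1 (a x)) bG).
apply: (le_mean (Gam1 (a x)) bnG (bounded_mfunD be bc)) => u.
have /andP[c0 c1] := chi01 l u.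
have [Fu|nFu] := pselect (F k u).
  rewrite (chiF l u Fu) mulr1 mulr2n mulrDl mul1r.
  by apply: (le_trans (bG.2 u)); rewrite lerDr ltW.
have [eG|Ge] := leP e `|G x u - G x0 u|.
  by case: nFu; apply: subset_closure; exists x.
by apply: (le_trans (ltW Ge)); rewrite lerDl !mulr_ge0.
Unshelve. all: by end_near. Qed.

(** The increment splits in two. With the test function [G x0] frozen, only the position [a x] moves
    and [hL2] applies. With the position [a x] frozen, the discontinuous factor [lam (a x)] is
    common and bounded by [M], and the change of test function is small by [tight] and by the
    continuity of [G]. *)
Lemma L2_param_Cb : Cb R (n.-tuple E) (fun x => L2 lam Gam (G x) (a x)).
Proof.
apply/CbP; split; last by exists (M * (2 * B)) => x; exact: norm_L2.
move=> x0.
have B0 : 0 <= B by exact: le_trans (normr_ge0 _) (GB x0 (a x0)).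
apply/(@cvgrPdist_lt _ _ _ (nbhs x0) (nbhs_filter x0)) => e e0.
(* [e1] is chosen so that the bound of [tight], multiplied by [M], equals e/4; the two other
   contributions are also at most e/4, for a total below e. *)
have c20 : 0 < 4 * (M * (1 + 2 * B)) by rewrite !mulr_gt0// ltr_wpDr ?mulr_ge0.
pose e1 := e / (4 * (M * (1 + 2 * B))).
have e10 : 0 < e1 by rewrite divr_gt0.
have Me : M * (e1 + 2 * B * e1) = e / 4.
  rewrite /e1; field; apply/andP; split; [|by rewrite gt_eqF].
  by rewrite gt_eqF// ltr_wpDr ?mulr_ge0.
have e2 : 0 < e / (4 * M) by rewrite divr_gt0// mulr_gt0.
have e4 : 0 < e / 4 by rewrite divr_gt0.
have cx0 : \forall x \near x0, `|L2 lam Gam (G x0) (a x) - L2 lam Gam (G x0) (a x0)| < e / 4.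
  have [cL _] : Cb R (E * E)%type (L2 lam Gam (G x0)).
    by apply: hL2; apply/CbP; split=> //; exists B.
  have : (fun x => L2 lam Gam (G x0) (a x)) @ x0 --> L2 lam Gam (G x0) (a x0).
    exact: (cvg_comp _ _ (@ca x0) (cL (a x0))).
  by move=> /cvgr_distC_lt /(_ _ e4).
have cG0 : \forall x \near x0, `|G x (a x) - G x0 (a x)| < e / (4 * M).
  have cxa : {for x0, continuous (fun x => (x, a x))}.
    by apply: continuous_pair; [exact: cvg_id|exact: ca].
  have : (fun x => G x (a x) - G x0 (a x)) @ x0 --> G x0 (a x0) - G x0 (a x0).
    exact: (cvg_comp _ _ cxa (@cGB x0 (x0, a x0))).
  by rewrite subrr => /cvgr0_norm_lt /(_ _ e2).
near=> x; rewrite distrC.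
have t1 : `|\int[Gam (a x)]_u (G x u - G x0 u)| <= e1 + 2 * B * e1.
  by near: x; exact: tight.
have t2 : `|G x (a x) - G x0 (a x)| < e / (4 * M) by near: x.
have t3 : `|L2 lam Gam (G x0) (a x) - L2 lam Gam (G x0) (a x0)| < e / 4.
  by near: x.
rewrite -(subrKA (L2 lam Gam (G x0) (a x))) (le_lt_trans (ler_normD _ _))//.
have -> : L2 lam Gam (G x) (a x) - L2 lam Gam (G x0) (a x) =
  lam (a x) * (\int[Gam (a x)]_u (G x u - G x0 u) - (G x (a x) - G x0 (a x))).
  rewrite (L2E _ (bGx x)) (L2E _ (bGx x0)) (meanB (Gam1 (a x)) (bGx x) (bGx x0)).
  ring.
rewrite normrM.
have : `|lam (a x)| * `|\int[Gam (a x)]_u (G x u - G x0 u)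
    - (G x (a x) - G x0 (a x))| <= M * (e1 + 2 * B * e1 + e / (4 * M)).
  rewrite ler_pM// ?normr_lam// (le_trans (ler_normB _ _))// lerD//; exact: ltW.
rewrite mulrDr Me (_ : M * _ = e / 4); last by field; rewrite gt_eqF.
lra.
Unshelve. all: by end_near. Qed.

End joint_continuity.

End collision_operator.

(** * The hierarchy of marginals *)

Section tuple_operations.
Variable T : Type.

Definition select k N (iota : 'I_k -> 'I_N) (z : N.-tuple T) : k.-tuple T :=
  [tuple tnth z (iota i) | i < k].

Definition set_coord k (z : k.-tuple T) (a : 'I_k) (u : T) : k.-tuple T :=
  [tuple if i == a then u else tnth z i | i < k].

(** The additional particle gets index [ord0], in agreement with [tuple_cons] and with the head read
    by [collide]. *)
Definition consf k N (j : 'I_N) (iota : 'I_k -> 'I_N) (i : 'I_k.+1) : 'I_N :=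
  if unlift ord0 i is Some i' then iota i' else j.

Lemma consf0 k N (j : 'I_N) (iota : 'I_k -> 'I_N) : consf j iota ord0 = j.
Proof. by rewrite /consf unlift_none. Qed.

Lemma consf_lift k N (j : 'I_N) (iota : 'I_k -> 'I_N) i :
  consf j iota (lift ord0 i) = iota i.
Proof. by rewrite /consf liftK. Qed.

Lemma consf_inj k N (j : 'I_N) (iota : 'I_k -> 'I_N) :
  injective iota -> (forall i, iota i != j) -> injective (consf j iota).
Proof.
move=> iotai iotaj i1 i2.
case: (unliftP ord0 i1) => [i1'|] ->; case: (unliftP ord0 i2) => [i2'|] ->;
  rewrite ?consf0 ?consf_lift //.
- by move=> /iotai ->.
- by move=> ij; have := iotaj i1'; rewrite ij eqxx.
- by move=> ij; have := iotaj i2'; rewrite ij eqxx.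
Qed.

Lemma select_consf k N (j : 'I_N) (iota : 'I_k -> 'I_N) (z : N.-tuple T) :
  select (lift ord0) (select (consf j iota) z) = select iota z.
Proof. by apply: eq_from_tnth => i; rewrite !tnth_mktuple consf_lift. Qed.

End tuple_operations.

Section tuple_operations_regularity.

Lemma select_continuous (T : topologicalType) k N (iota : 'I_k -> 'I_N) :
  continuous (@select T k N iota).
Proof.
apply: continuous_tuple => i.
rewrite (_ : (fun x => _) = (fun z => tnth z (iota i))).
  exact: tnth_continuous.
by apply/funext => z; rewrite tnth_mktuple.
Qed.

Lemma measurable_select d (T : measurableType d) k N (iota : 'I_k -> 'I_N) :
  measurable_fun setT (@select T k N iota).
Proof.
apply/measurable_fun_tnthP => i.
rewrite [X in measurable_fun _ X](_ : _ = (@tnth _ T)^~ (iota i)).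
  exact: measurable_tnth.
by apply/funext => z /=; rewrite tnth_mktuple.
Qed.

Lemma set_coord_continuous (X T : topologicalType) k (a : 'I_k)
    (f : X -> k.-tuple T) (g : X -> T) :
  continuous f -> continuous g -> continuous (fun x => set_coord (f x) a (g x)).
Proof.
move=> cf cg; apply: continuous_tuple => i.
rewrite (_ : (fun x => _) = if i == a then g else (fun x => tnth (f x) i)).
  case: ifP => // _ x.
  exact: (cvg_comp _ _ (cf x) (@tnth_continuous _ _ i (f x))).
by apply/funext => z; rewrite tnth_mktuple; case: ifP.
Qed.

Lemma measurable_set_coord d d' (X : measurableType d) (T : measurableType d')
    k (a : 'I_k) (f : X -> k.-tuple T) (g : X -> T) :
  measurable_fun setT f -> measurable_fun setT g ->
  measurable_fun setT (fun x => set_coord (f x) a (g x)).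
Proof.
move=> mf mg; apply/measurable_fun_tnthP => i.
rewrite [X in measurable_fun _ X](_ : _ =
    if i == a then g else (fun x => tnth (f x) i)).
  by case: ifP => // _; exact: (measurableT_comp (measurable_tnth i) mf).
by apply/funext => z /=; rewrite tnth_mktuple; case: ifP.
Qed.

End tuple_operations_regularity.

(** * Measurability of the rate and exchange symmetry of collisions *)

Section exchange.
Context (R : realType) (E : completePseudoMetricType R).
Hypothesis hE : polish_space E.
Variables (lam : E * E -> R)
          (Gam : E * E -> probability (borel E * borel E)%type R).
Hypothesis hlam : collision_rate lam.
Hypothesis hGam : post_collisional Gam.

(** In a Hausdorff space the complement of the diagonal is open, hence measurable for the product
    sigma-algebra; on the diagonal the rate is 0. *)
Lemma measurable_lam : measurable_fun setT (lam : borel E * borel E -> R).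
Proof.
have [_ _ mlam lam0] := hlam.
pose D := [set z : borel E * borel E | z.1 <> z.2].
have oD : open (D : set (E * E)).
  have [hausE _] := hE; rewrite openE => -[x y] /= xy.
  have [[U V] /= [xU yV] [oU oV UV]] : exists2 AB, (x \in AB.1 /\ y \in AB.2) &
      [/\ open AB.1, open AB.2 & AB.1 `&` AB.2 == set0].
    by move: hausE; rewrite open_hausdorff; apply; exact/eqP.
  exists (U, V); first by split; apply: open_nbhs_nbhs; split => //; exact: set_mem.
  move=> [u v] /= [Uu Vv] /= uv; have /eqP UV0 := UV.
  by have : set0 u by rewrite -UV0; split=> //; move: uv => /= ->.
have mD : measurable D by exact: (open_prod_measurable hE).
rewrite -(setUv D); apply/measurable_funU => //; first exact: measurableC.
split; first exact: mlam.
have lamD0 : {in ~` D, cst (0 : R) =1 lam}.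
  by move=> -[x y]; rewrite inE => /contrapT /= ->; rewrite lam0.
exact: (eq_measurable_fun _ lamD0).
Qed.

(** This frees the generator from the ordering i < j: a pair whose followed particle comes second
    can be read with that particle first. *)
Lemma L2_swap B (phi : E * E -> R) (x y : E) :
  bounded_mfun B (phi : borel E * borel E -> R) ->
  L2 lam Gam (fun p => phi (p.2, p.1)) (y, x) = L2 lam Gam phi (x, y).
Proof.
move=> bphi; have [_ lamC _ _] := hlam; rewrite /L2 lamC; congr (_ * _).
pose sw := mfun_Sub (mem_set (@measurable_swap _ _ (borel E) (borel E))).
have bphi' := bounded_mfunB bphi (bounded_mfun_cst (borel E * borel E)%type (phi (x, y))).
transitivity (\int[distribution (Gam (y, x)) sw]_z' (phi z' - phi (x, y))).
  rewrite (mean_pushforward _ sw bphi') /=.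
  by apply: eq_Rintegral.
rewrite /Rintegral; congr fine; apply: eq_measure_integral => A mA _.
exact: (esym (hGam.2 x y A mA)).
Qed.

End exchange.

(** * The hierarchy acting on test functions *)

Section collision_dual.
Context (R : realType) (E : completePseudoMetricType R).
Hypothesis hE : polish_space E.
Variables (lam : E * E -> R)
          (Gam : E * E -> probability (borel E * borel E)%type R).
Hypothesis hlam : collision_rate lam.
Hypothesis hGam : post_collisional Gam.
Hypothesis hL2 : forall phi, Cb R (E * E)%type phi ->
  Cb R (E * E)%type (L2 lam Gam phi).
Variable M : R.
Hypothesis M0 : 0 < M.
Hypothesis lamM : forall z, lam z <= M.

(* The particle [z_a] collides with an independent particle, the head of [y];
   the result of the collision for the latter is discarded. *)
Definition collide k (phi : k.-tuple E -> R) (a : 'I_k) (y : k.+1.-tuple E) : R :=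
  L2 lam Gam (fun p => phi (set_coord (select (lift ord0) y) a p.1))
     (tnth y (lift ord0 a), tnth y ord0).

Definition hierarchy k (phi : k.-tuple E -> R) (y : k.+1.-tuple E) : R :=
  \sum_(a < k) collide phi a y.

(** Measurable counterpart of [L2_param_Cb], for test functions obtained as sections or means; it
    rests on [Gam] being a kernel. *)
Lemma bounded_mfun_L2_param d (X : measurableType d) B
    (G : X -> E * E -> R) (a : X -> E * E) :
  bounded_mfun B (fun p : X * (borel E * borel E) => G p.1 p.2) ->
  measurable_fun setT (a : X -> borel E * borel E) ->
  bounded_mfun (M * (2 * B)) (fun x => L2 lam Gam (G x) (a x)).
Proof.
move=> bG ma.
have mG A : measurable A -> measurable_fun setT (fun x : X => Gam (a x) A).
  by move=> mA; exact: (measurableT_comp (post_collisional_kernel hE hGam mA) ma).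
have bGa : bounded_mfun B (fun x => G x (a x)).
  split; last by move=> x; exact: (bG.2 (x, a x)).
  have mp : measurable_fun setT (fun x : X => (x, a x : borel E * borel E)).
    exact: (measurable_fun_pair (@measurable_id _ X setT) ma).
  exact: (measurableT_comp bG.1 mp).
have bGx x : bounded_mfun B (G x : borel E * borel E -> R).
  split; last by move=> u; exact: (bG.2 (x, u)).
  exact: (measurableT_comp bG.1 (pair1_measurable x)).
rewrite (_ : (fun x => _) =
    fun x => lam (a x) * (\int[Gam (a x)]_u G x u - G x (a x))).
  rewrite mulr2n mulrDl mul1r; apply: bounded_mfunM.
    split=> [|x]; last exact: normr_lam.
    exact: (measurableT_comp (measurable_lam hE hlam) ma).
  by apply: bounded_mfunB bGa; exact: (bounded_mfun_kernel_mean mG bG).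
by apply/funext => x; rewrite (L2E lam Gam (a x) (bGx x)).
Qed.

Lemma bounded_mfun_collide k (phi : k.-tuple E -> R) (a : 'I_k) B :
  bounded_mfun B (phi : k.-tuple (borel E) -> R) ->
  bounded_mfun (M * (2 * B)) (collide phi a : k.+1.-tuple (borel E) -> R).
Proof.
move=> bphi; apply: (@bounded_mfun_L2_param _ (k.+1.-tuple (borel E)) B
  (fun y p => phi (set_coord (select (lift ord0) y) a p.1))
  (fun y => (tnth y (lift ord0 a), tnth y ord0))).
  apply: (bounded_mfun_comp _ bphi).
  apply: measurable_set_coord.
    exact: (measurableT_comp (measurable_select _) measurable_fst).
  exact: (measurableT_comp measurable_fst measurable_snd).
by apply: measurable_fun_pair; exact: measurable_tnth.
Qed.

Lemma bounded_mfun_hierarchy k (phi : k.-tuple E -> R) B :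
  bounded_mfun B (phi : k.-tuple (borel E) -> R) ->
  bounded_mfun (k%:R * (M * (2 * B))) (hierarchy phi : k.+1.-tuple (borel E) -> R).
Proof.
move=> bphi; have := bounded_mfun_sum (index_enum 'I_k) xpredT
  (fun a => bounded_mfun_collide a bphi).
by rewrite sumr_const card_ord -[_ *+ k]mulr_natl.
Qed.

Lemma collide_Cb k (phi : k.-tuple E -> R) (a : 'I_k) :
  Cb R (k.-tuple E) phi -> Cb R (k.+1.-tuple E) (collide phi a).
Proof.
move=> /CbP[cphi [B phiB]].
apply: (@L2_param_Cb _ _ hE _ _ hlam hGam hL2 _ M0 lamM k.+1
  (fun y p => phi (set_coord (select (lift ord0) y) a p.1))
  (fun y => (tnth y (lift ord0 a), tnth y ord0)) B) => //.
  move=> p; apply: (@continuous_comp _ _ _ (fun p : k.+1.-tuple E * (E * E) =>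
    set_coord (select (lift ord0) p.1) a p.2.1) phi); last exact: cphi.
  apply: set_coord_continuous => q.
    apply: (@continuous_comp _ _ _ fst (select (lift ord0)) q).
      exact: cvg_fst.
    exact: select_continuous.
  by apply: (@continuous_comp _ _ _ snd fst q); [exact: cvg_snd|exact: cvg_fst].
move=> y; apply: (@continuous_pair _ _ _ (fun y => tnth y (lift ord0 a))
  (fun y => tnth y ord0)); exact: tnth_continuous.
Qed.

Lemma Cb_sum (X : topologicalType) (I : Type) (s : seq I) (P : pred I)
    (f : I -> X -> R) : (forall i, Cb R X (f i)) ->
  Cb R X (fun x => \sum_(i <- s | P i) f i x).
Proof.
move=> fCb; apply/CbP; split.
  apply: (@continuous_big _ _ _ _ _ _) => [|i _]; first exact: add_continuous.
  by have /CbP[] := fCb i.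
have /choice[B fB] i : exists B : R, forall x, `|f i x| <= B.
  by have /CbP[] := fCb i.
exists (\sum_(i <- s | P i) B i) => x.
by apply: (le_trans (ler_norm_sum _ _ _)); exact: ler_sum.
Qed.

(** This is what allows the hierarchy to be iterated: each new test function is again one on which
    the particle generator is known. *)
Lemma hierarchy_Cb k (phi : k.-tuple E -> R) :
  Cb R (k.-tuple E) phi -> Cb R (k.+1.-tuple E) (hierarchy phi).
Proof. by move=> phiCb; apply: Cb_sum => a; exact: collide_Cb. Qed.

Lemma diamond_Cb N (i j : 'I_N) (phi : N.-tuple E -> R) :
  Cb R (N.-tuple E) phi -> Cb R (N.-tuple E) (diamond lam Gam i j phi).
Proof.
move=> /CbP[cphi [B phiB]].
apply: (@L2_param_Cb _ _ hE _ _ hlam hGam hL2 _ M0 lamM N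
  (fun z p => phi (subst2 z i j p.1 p.2))
  (fun z => (tnth z i, tnth z j)) B) => //; last first.
  move=> y; apply: (@continuous_pair _ _ _ (fun y => tnth y i)
    (fun y => tnth y j)); exact: tnth_continuous.
move=> p; apply: (@continuous_comp _ _ _ (fun p : N.-tuple E * (E * E) =>
  subst2 p.1 i j p.2.1 p.2.2) phi); last exact: cphi.
apply: continuous_tuple => l.
rewrite (_ : (fun x => _) = fun x : N.-tuple E * (E * E) =>
   if l == i then x.2.1 else if l == j then x.2.2 else tnth x.1 l); last first.
  by apply/funext => x; rewrite tnth_mktuple.
move=> q; case: (l == i).
  by apply: (@continuous_comp _ _ _ snd fst q); [exact: cvg_snd|exact: cvg_fst].
case: (l == j).
  by apply: (@continuous_comp _ _ _ snd snd q); [exact: cvg_snd|exact: cvg_snd].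
apply: (@continuous_comp _ _ _ fst (fun z => tnth z l) q); first exact: cvg_fst.
exact: tnth_continuous.
Qed.

Lemma particle_generator_Cb N (phi : N.-tuple E -> R) :
  Cb R (N.-tuple E) phi -> Cb R (N.-tuple E) (particle_generator lam Gam phi).
Proof.
move=> phiCb.
have /CbP[cs [B sB]] : Cb R (N.-tuple E) (fun z =>
    \sum_(i < N) \sum_(j < N | (i < j)%N) diamond lam Gam i j phi z).
  by apply: Cb_sum => i; apply: Cb_sum => j; exact: diamond_Cb.
apply/CbP; split; last first.
  by exists (`|N%:R^-1| * B) => z; rewrite normrM ler_wpM2l.
move=> z; apply: (continuous_comp (cs z)); exact: mulrl_continuous.
Qed.

End collision_dual.

(** * The particle generator on functions of few particles *)

Section generator_on_marginals.
Context (R : realType) (E : completePseudoMetricType R).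
Hypothesis hE : polish_space E.
Variables (lam : E * E -> R)
          (Gam : E * E -> probability (borel E * borel E)%type R).
Hypothesis hlam : collision_rate lam.
Hypothesis hGam : post_collisional Gam.
Variable M : R.
Hypothesis M0 : 0 < M.
Hypothesis lamM : forall z, lam z <= M.

Lemma L2_cst (c : R) z : L2 lam Gam (fun=> c) z = 0.
Proof.
rewrite /L2 (_ : \int[Gam z]_z' (c - c) = 0) ?mulr0//.
by rewrite subrr; exact: (mean_cst (probability_setT (Gam z))).
Qed.

Section pairs.
Variables (N : nat) (z : N.-tuple E).

Lemma bounded_mfun_subst2 (psi : N.-tuple E -> R) B i j :
  bounded_mfun B (psi : N.-tuple (borel E) -> R) ->
  bounded_mfun B
    ((fun p => psi (subst2 z i j p.1 p.2)) : borel E * borel E -> R).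
Proof.
move=> bpsi; apply: (@bounded_mfun_comp _ _ (borel E * borel E)%type
  (N.-tuple (borel E)) _ _ _ (fun p => subst2 z i j p.1 p.2)) => //.
apply/measurable_fun_tnthP => l.
rewrite [X in measurable_fun _ X](_ : _ =
    if l == i then fst else if l == j then snd else cst (tnth z l)).
  case: (l == i); first exact: measurable_fst.
  by case: (l == j); [exact: measurable_snd|exact: measurable_cst].
by apply/funext => p /=; rewrite tnth_mktuple; case: (l == i); case: (l == j).
Qed.

Lemma diamond_sym (psi : N.-tuple E -> R) B i j :
  bounded_mfun B (psi : N.-tuple (borel E) -> R) -> i != j ->
  diamond lam Gam i j psi z = diamond lam Gam j i psi z.
Proof.
move=> bpsi ij; rewrite /diamond.
rewrite -(L2_swap hlam hGam _ _ (bounded_mfun_subst2 i j bpsi)).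
congr (L2 lam Gam _ _); apply/funext => p; congr psi.
apply: eq_from_tnth => l; rewrite !tnth_mktuple.
by case: (eqVneq l i) => [->|//]; rewrite (negbTE ij).
Qed.

Lemma norm_diamond (psi : N.-tuple E -> R) B i j :
  bounded_mfun B (psi : N.-tuple (borel E) -> R) ->
  `|diamond lam Gam i j psi z| <= M * (2 * B).
Proof.
by move=> bpsi; apply: norm_L2 => //; exact: bounded_mfun_subst2.
Qed.

Variables (k : nat) (iota : 'I_k -> 'I_N) (phi : k.-tuple E -> R).
Hypothesis iotaI : injective iota.

Lemma diamond_select_out i j :
  (forall a, iota a != i) -> (forall a, iota a != j) ->
  diamond lam Gam i j (phi \o select iota) z = 0.
Proof.
move=> ii ij; rewrite /diamond -[RHS](L2_cst (phi (select iota z)) (tnth z i, tnth z j)).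
congr (L2 lam Gam _ _); apply/funext => p /=; congr phi.
apply: eq_from_tnth => a; rewrite !tnth_mktuple.
by rewrite (negbTE (ii a)) (negbTE (ij a)).
Qed.

(** The new state of the unfollowed particle [j] is invisible to [phi], in agreement with [collide],
    which discards it. *)
Lemma diamond_select a j : (forall a, iota a != j) ->
  diamond lam Gam (iota a) j (phi \o select iota) z =
  collide lam Gam phi a (select (consf j iota) z).
Proof.
move=> ij; rewrite /diamond /collide select_consf; congr (L2 lam Gam _ _).
  apply/funext => p /=; congr phi.
  apply: eq_from_tnth => b; rewrite !tnth_mktuple.
  by rewrite (inj_eq iotaI) (negbTE (ij b)).
by rewrite !tnth_mktuple consf0 consf_lift.
Qed.

End pairs.

(* Pairs outside the range of iota contribute nothing and pairs with exactly one
   element in it give the hierarchy; the error comes from the pairs inside it. *)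
Lemma generator_select k N (iota : 'I_k -> 'I_N) (phi : k.-tuple E -> R) B z :
  injective iota -> bounded_mfun B (phi : k.-tuple (borel E) -> R) ->
  `|particle_generator lam Gam (phi \o select iota) z
    - N%:R^-1 * \sum_(j in ~: (iota @: 'I_k))
                  hierarchy lam Gam phi (select (consf j iota) z)|
  <= N%:R^-1 * (k%:R * (k%:R * (M * (2 * B)))).
Proof.
move=> iotaI bphi; set S := iota @: 'I_k.
have bpsi : bounded_mfun B (phi \o select iota : N.-tuple (borel E) -> R).
  exact: (bounded_mfun_comp (measurable_select _) bphi).
pose d i j := diamond lam Gam i j (phi \o select iota) z.
have notS j : j \notin S -> forall a, iota a != j.
  move=> jS a; apply: contraNneq jS => <-; exact: imset_f.
have cardS : #|S| = k by rewrite card_imset// card_ord.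
rewrite /particle_generator -mulrBr normrM ger0_norm ?invr_ge0 ?ler0n//.
rewrite ler_wpM2l ?invr_ge0 ?ler0n//.
suff -> : \sum_(i < N) \sum_(j < N | (i < j)%N) d i j =
    \sum_(i in S) \sum_(j < N | (i < j)%N && (j \in S)) d i j +
    \sum_(j in ~: S) hierarchy lam Gam phi (select (consf j iota) z).
  rewrite addrK (le_trans (ler_norm_sum _ _ _))//.
  rewrite -[X in X%:R * _]cardS mulr_natl -sumr_const; apply: ler_sum => i iS.
  rewrite (le_trans (ler_norm_sum _ _ _))//.
  rewrite -[X in X%:R * _]cardS mulr_natl -sumr_const [leLHS]big_mkcond /=.
  rewrite [leRHS]big_mkcond /=; apply: ler_sum => j _.
  have B0 : 0 <= B by exact: (le_trans (normr_ge0 _) (bpsi.2 z)).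
  have MB0 : 0 <= M * (2 * B) by rewrite !mulr_ge0// ltW.
  case: (j \in S); rewrite ?andbF ?andbT//.
  by case: ifP => // _; exact: norm_diamond.
have -> : \sum_(j in ~: S) hierarchy lam Gam phi (select (consf j iota) z) =
    \sum_(i in S) \sum_(j in ~: S) d i j.
  rewrite [RHS]exchange_big /=; apply: eq_bigr => j; rewrite inE => /notS jS.
  rewrite big_imset /=; last by move=> a b _ _; exact: iotaI.
  by apply: eq_bigr => a _; rewrite /d diamond_select.
rewrite (bigID (mem S)) /=.
have eqS i : i \in S -> \sum_(j < N | (i < j)%N) d i j =
   \sum_(j < N | (i < j)%N && (j \in S)) d i j +
   \sum_(j in ~: S | (i < j)%N) d i j.
  move=> _; rewrite (bigID (mem S)) /=; congr (_ + _).
  by apply: eq_bigl => j; rewrite inE andbC.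
rewrite (eq_bigr _ eqS) big_split /= -addrA; congr (_ + _).
(* When [i] is outside [S], the pairs with [j] outside vanish, and those with [j] in [S] are turned
   around by symmetry so that the followed particle comes first. *)
have -> : \sum_(i < N | i \notin S) \sum_(j < N | (i < j)%N) d i j =
    \sum_(i in S) \sum_(j in ~: S | (j < i)%N) d i j.
  rewrite [RHS](exchange_big_dep (fun j => j \in ~: S)) /=; last by move=> i j _ /andP[].
  rewrite [LHS](eq_bigl (fun i => i \in ~: S)); last by move=> j; rewrite !inE.
  apply: eq_bigr => i iS'; have iS : i \notin S by move: iS'; rewrite inE.
  rewrite (bigID (mem S)) /= [X in _ + X]big1 ?addr0; last first.
    by move=> j /andP[_ jS]; rewrite /d; apply: diamond_select_out; exact: notS.
  rewrite (eq_bigl (fun j => (j \in S) && ((i \in ~: S) && (i < j)%N))); last first.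
    by move=> j; rewrite !inE iS /= andbC.
  apply: eq_bigr => j /andP[jS _]; rewrite /d (diamond_sym _ bpsi)//.
  by apply: contraNneq iS => ->.
(* For [i] in [S] and [j] outside, equality is impossible, so the ranges i < j and j < i together
   exhaust the complement of [S]. *)
rewrite -big_split /=; apply: eq_bigr => i iS.
rewrite [RHS](bigID (fun j : 'I_N => (i < j)%N)) /=; congr (_ + _).
apply: eq_bigl => j; rewrite inE -leqNgt ltn_neqAle.
case: (boolP (j \in S)) => //= jS; rewrite andbC; case: leqP => //= _.
by apply: contraNneq jS => /val_inj ->.
Qed.

End generator_on_marginals.

(** * Uniform right derivatives *)

Section uniform_right_derivative.
Variable R : realType.
Implicit Types (F G : R -> R) (t h a c : R).

(* The remainder is uniform in t, so that an increment is a Riemann sum of F' up to a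
   vanishing error, without any regularity of F'. *)
Definition uniform_right_derivative F F' := forall eta, 0 < eta ->
  exists2 delta, 0 < delta & forall t h, 0 <= t -> 0 < h <= delta ->
    `|F (t + h) - F t - h * F' t| <= eta * h.

Lemma uniform_right_derivativeB F F' G G' :
  uniform_right_derivative F F' -> uniform_right_derivative G G' ->
  uniform_right_derivative (fun t => F t - G t) (fun t => F' t - G' t).
Proof.
move=> dF dG eta eta0; have eta20 : 0 < eta / 2 by rewrite divr_gt0.
have [d d0 dP] := dF _ eta20; have [e e0 eP] := dG _ eta20.
exists (Num.min d e) => [|t h t0]; first by rewrite lt_min d0 e0.
rewrite le_min => /and3P[h0 hd he].
have -> : F (t + h) - G (t + h) - (F t - G t) - h * (F' t - G' t) =
  (F (t + h) - F t - h * F' t) - (G (t + h) - G t - h * G' t) by ring.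
apply: (le_trans (ler_normB _ _)).
have := dP t h t0; have := eP t h t0; rewrite h0 hd he => /(_ isT) ? /(_ isT) ?.
rewrite (splitr eta) mulrDl; exact: lerD.
Qed.

(** Convexity of the power function: a left Riemann sum of u^n stays below its primitive
    u^(n+1)/(n+1). *)
Lemma exprD_ge_tangent (u h : R) n : 0 <= u -> 0 <= h ->
  u ^+ n.+1 + n.+1%:R * (h * u ^+ n) <= (u + h) ^+ n.+1.
Proof.
move=> u0 h0; elim: n => [|n ih]; first by rewrite !expr1 expr0 mulr1 mul1r.
rewrite [leRHS]exprS; apply: le_trans (ler_wpM2l (addr_ge0 u0 h0) ih).
have -> : (u + h) * (u ^+ n.+1 + n.+1%:R * (h * u ^+ n)) =
  u ^+ n.+2 + n.+2%:R * (h * u ^+ n.+1) + n.+1%:R * (h * h * u ^+ n).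
  rewrite (natrD _ 1 n.+1) !exprS; ring.
by rewrite lerDl mulr_ge0// mulr_ge0 ?exprn_ge0// mulr_ge0.
Qed.

(** On a subdivision of [t0, t0 + u] finer than [d], each increment of [F] is [h F'] up to
    [(e / u) h]. The errors add up to e, and the left Riemann sums of the nondecreasing bound a + c
    v^n lie below its primitive [G]. *)
Lemma uniform_right_derivative_le F F' t0 T a c n :
  uniform_right_derivative F F' -> 0 <= t0 -> 0 <= a -> 0 <= c ->
  (forall u, 0 <= u <= T -> `|F' (t0 + u)| <= a + c * u ^+ n) ->
  forall u, 0 <= u <= T ->
    `|F (t0 + u) - F t0| <= a * u + c * u ^+ n.+1 / n.+1%:R.
Proof.
move=> dF t00 a0 c0 F'le u /andP[u0 uT].
have [->|un0] := eqVneq u 0.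
  by rewrite addr0 subrr normr0 expr0n !mulr0 mul0r addr0.
have {un0}u0 : 0 < u by rewrite lt_def un0.
apply/ler_addgt0Pr => e e0.
have [d d0 dP] := dF _ (divr_gt0 e0 u0).
have [m md] := small_inv_nat (divr_gt0 d0 u0).
have m0 : 0 < m.+1%:R :> R by rewrite ltr0n.
pose h := u / m.+1%:R.
have h0 : 0 < h by rewrite divr_gt0.
have hd : h <= d by move: md; rewrite ltr_pdivlMr// mulrC => /ltW.
pose G v := a * v + c * v ^+ n.+1 / n.+1%:R.
suff H k : (k <= m.+1)%N ->
    `|F (t0 + k%:R * h) - F t0| <= G (k%:R * h) + e / u * (k%:R * h).
  have := H m.+1 (leqnn _).
  by rewrite /h mulrCA divff ?gt_eqF// mulr1 divfK ?gt_eqF.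
elim: k => [_|k ih km].
  by rewrite mul0r addr0 subrr normr0 /G expr0n !mulr0 mul0r !addr0.
have kh0 : 0 <= k%:R * h by rewrite mulr_ge0// ltW.
have khT : k%:R * h <= T.
  apply: (le_trans _ uT); rewrite /h mulrCA ler_piMr ?(ltW u0)//.
  by rewrite ler_pdivrMr// mul1r ler_nat ltnW.
have -> : t0 + k.+1%:R * h = (t0 + k%:R * h) + h.
  by rewrite -natr1; ring.
set t := t0 + k%:R * h.
have t_ge0 : 0 <= t by rewrite addr_ge0.
have := dP t h t_ge0; rewrite h0 hd => /(_ isT) dFt.
have F't : `|F' t| <= a + c * (k%:R * h) ^+ n by apply: F'le; rewrite kh0.
have := ih (ltnW km); rewrite -/t => {}ih.
have -> : F (t + h) - F t0 =
  (F (t + h) - F t - h * F' t) + (F t - F t0) + h * F' t by ring.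
apply: (le_trans (ler_normD _ _)); rewrite normrM (gtr0_norm h0).
apply: (le_trans (lerD (ler_normD _ _) (ler_wpM2l (ltW h0) F't))).
apply: (le_trans (lerD (lerD dFt ih) (lexx _))).
(* One step of the left Riemann sum against the primitive, by [exprD_ge_tangent]. *)
have Gk : G (k%:R * h) + h * (a + c * (k%:R * h) ^+ n) <= G (k.+1%:R * h).
  rewrite /G (_ : k.+1%:R * h = k%:R * h + h); last by rewrite -natr1; ring.
  have := exprD_ge_tangent n kh0 (ltW h0).
  move: (k%:R * h) kh0 => v v0 tang.
  have q0 : n.+1%:R != 0 :> R by rewrite pnatr_eq0.
  have -> : a * v + c * v ^+ n.+1 / n.+1%:R + h * (a + c * v ^+ n) =
    a * (v + h) + c / n.+1%:R * (v ^+ n.+1 + n.+1%:R * (h * v ^+ n)).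
    by move: (n.+1%:R) q0 (v ^+ n.+1) => q q0 w; field.
  rewrite lerD2l [leRHS]mulrAC ler_wpM2l// divr_ge0 ?ler0n//.
apply: le_trans (_ : G (k.+1%:R * h) + (e / u * h + e / u * (k%:R * h)) <= _).
  move: Gk; lra.
by rewrite lerD2l -mulrDr -natr1 mulrDl mul1r (addrC h).
Qed.

End uniform_right_derivative.

(** * Mixtures of probability measures *)

Section bind_probability.
Context d d' (S : measurableType d) (T : measurableType d') (R : realType).
Variables (mu : probability S R) (P : S -> probability T R).
Hypothesis mP : forall A, measurable A -> measurable_fun setT (fun x => P x A).

Let mmu (A : set S) : measurable A -> measurable_fun setT (fun _ : unit => mu A).
Proof. by move=> _; exact: measurable_cst. Qed.

Let mP2 (A : set T) : measurable A ->
  measurable_fun setT (fun p : unit * S => P p.2 A).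
Proof. by move=> mA; exact: (measurableT_comp (mP mA) measurable_snd). Qed.

Let l := kernel_of_probability (P := fun _ : unit => mu) mmu.
Let k := kernel_of_probability (P := fun p : unit * S => P p.2) mP2.

(** The measure [mu] is seen as a kernel from the one-point space, so that the mixture is a
    composition of kernels. The measurability proof is an argument so that the measure instances can
    be attached to the term. *)
Definition bind_measure of
    (forall A, measurable A -> measurable_fun setT (fun x => P x A)) :
  set T -> \bar R := (l \; k)%E tt.

Let bind_measure1 : bind_measure mP setT = 1%E.
Proof.
rewrite /bind_measure/= /kcomp/=.
under eq_integral do rewrite /k /kernel_of_probability probability_setT.
by rewrite integral_cst// mul1e; exact: probability_setT.
Qed.

HB.instance Definition _ := Measure.on (bind_measure mP).
HB.instance Definition _ :=
  Measure_isProbability.Build _ _ _ (bind_measure mP) bind_measure1.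

Definition bind : probability T R := bind_measure mP.

Lemma bindE A : bind A = (\int[mu]_x P x A)%E.
Proof. by []. Qed.

Lemma mean_bind B (f : T -> R) : bounded_mfun B f ->
  \int[bind]_y f y = \int[mu]_x \int[P x]_y f y.
Proof.
move=> bf; have bB := bounded_mfun_cst T B.
have P1 x := probability_setT (P x).
have bPf : bounded_mfun B (fun x => \int[P x]_y f y).
  apply: (bounded_mfun_kernel_mean mP (f := f \o snd)).
  exact: (bounded_mfun_comp measurable_snd bf).
have bi1 := probability_setT bind; have mu1 := probability_setT mu.
(* The shift by [B] makes the integrand nonnegative, as [integral_kcomp] demands. *)
suff : \int[bind]_y (f y + B) = \int[mu]_x (\int[P x]_y f y + B).
  rewrite (meanD bi1 bf bB) (meanD mu1 bPf (bounded_mfun_cst S B)).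
  by rewrite (mean_cst bi1) (mean_cst mu1) => /addIr.
rewrite /Rintegral; congr fine.
rewrite /bind /bind_measure integral_kcomp//=; last 2 first.
- move=> y; rewrite lee_fin -lerBlDr sub0r.
  by have := bf.2 y; rewrite ler_norml => /andP[].
- by apply/measurable_EFinP; exact: (bounded_mfunD bf bB).1.
apply: eq_integral => x _; rewrite /k /kernel_of_probability /=.
rewrite -(EFin_mean (P1 x) (bounded_mfunD bf bB)) (meanD (P1 x) bf bB).
by rewrite (mean_cst (P1 x)).
Qed.

End bind_probability.

Section kernel_probability.
Context d d' (S : measurableType d) (T : measurableType d') (R : realType).
Variable k : R.-pker S ~> T.

Let kx x : set T -> \bar R := k x.

HB.instance Definition _ x := Measure.on (kx x).
HB.instance Definition _ x :=
  Measure_isProbability.Build _ _ _ (kx x) (prob_kernel x).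

Definition kernel_probability x : probability T R := kx x.

End kernel_probability.

(** * Right derivatives along a Markov process *)

Section markov_generator.
Context (R : realType) d (Omega : measurableType d) (P : probability Omega R).

(** The hypothesis says that the law of [Y] is the mixture of the kernel by the law of [X];
    [mean_bind] passes from events to functions. *)
Lemma mean_transition d' (S : measurableType d') (X Y : {RV P >-> S})
    (k : R.-pker S ~> S) B (f : S -> R) :
  (forall A, measurable A -> P (Y @^-1` A) = (\int[P]_w k (X w) A)%E) ->
  bounded_mfun B f ->
  \int[P]_w f (Y w) = \int[P]_w \int[k (X w)]_y f y.
Proof.
move=> XY bf; pose kp := kernel_probability k.
have mk (A : set S) : measurable A -> measurable_fun setT (fun x => kp x A).
  by move=> mA; exact: measurable_kernel.
have bkf : bounded_mfun B (fun x => \int[kp x]_y f y).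
  apply: (bounded_mfun_kernel_mean mk (f := f \o snd)).
  exact: (bounded_mfun_comp measurable_snd bf).
rewrite -(mean_pushforward P Y bf).
transitivity (\int[bind (distribution P X) mk]_y f y).
  rewrite /Rintegral; congr fine; apply: eq_measure_integral => A mA _.
  transitivity (\int[distribution P X]_x kp x A)%E; last by [].
  by rewrite ge0_integral_distribution//; [exact: XY|exact: mk].
by rewrite (mean_bind _ _ bf) (mean_pushforward P X bkf).
Qed.

Variables (E : completePseudoMetricType R) (hE : polish_space E).
Variables (N : nat) (Z : R -> {RV P >-> N.-tuple (borel E)}).
Variable L : (N.-tuple E -> R) -> N.-tuple E -> R.
Hypothesis ZL : markov_with_generator Z L.
Hypothesis LCb : forall phi, Cb R (N.-tuple E) phi -> Cb R (N.-tuple E) (L phi).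

Lemma Cb_bounded_mfun n phi : Cb R (n.-tuple E) phi ->
  exists B, bounded_mfun B (phi : n.-tuple (borel E) -> R).
Proof.
move=> /CbP[cphi [B phiB]]; exists B; split=> //.
exact: continuous_measurable_tuple.
Qed.

(** The Markov property is used with the sure event only. The difference quotient of the semigroup
    approaches [L phi] uniformly in the state, so the threshold on h does not depend on t. *)
Lemma markov_right_derivative phi : Cb R (N.-tuple E) phi ->
  uniform_right_derivative (fun t => \int[P]_w phi (Z t w))
    (fun t => \int[P]_w L phi (Z t w)).
Proof.
move=> phiCb eta eta0; have [K [K0 ZK KL]] := ZL.
have [B bphi] := Cb_bounded_mfun phiCb.
have [C bL] := Cb_bounded_mfun (LCb phiCb).
have [d0 d00 dP] : exists2 d, 0 < d & forall h, 0 < h < d -> forall x,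
    `|L phi x - h^-1 * (\int[K h x]_y phi y - phi x)| < eta.
  have : nbhs (L phi : {uniform N.-tuple E -> R})
      [set g | forall x, `|L phi x - g x| < eta].
    apply/uniform_nbhs; exists [set xy | ball xy.1 eta xy.2]; split.
      exact: (entourage_ball _ (PosNum eta0)).
    by move=> g gP x; exact: (gP x I).
  move=> /(KL _ phiCb) [d0 /= d00 dP]; exists d0 => // h /andP[h0 hd] x.
  by apply: (dP h) => //=; rewrite sub0r normrN gtr0_norm.
exists (d0 / 2) => [|t h t0 /andP[h0 hd]]; first by rewrite divr_gt0.
have hd0 : 0 < h < d0.
  by rewrite h0 (le_lt_trans hd)// ltr_pdivrMr// ltr_pMr// ltr1n.
have ZKh A : measurable A -> P (Z (t + h) @^-1` A) = (\int[P]_w K h (Z t w) A)%E.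
  move=> mA; rewrite -(ZK t h setT A)//; first by rewrite setTI.
    exact: ltW.
  rewrite -setC0; apply: sigma_algebraC; exact: sigma_algebra0.
have P1 := probability_setT P.
have mZ : measurable_fun setT (Z t) by [].
have bphiZ := bounded_mfun_comp mZ bphi.
have bLZ := bounded_mfun_comp mZ bL.
have bK : bounded_mfun B (fun x => \int[K h x]_y phi y).
  apply: (bounded_mfun_mean (K h) (f := phi \o snd)).
  exact: (bounded_mfun_comp measurable_snd bphi).
have bKZ := bounded_mfun_comp mZ bK.
rewrite (mean_transition ZKh bphi) -(meanB P1 bKZ bphiZ) -(meanZ P1 _ bLZ).
rewrite -(meanB P1 (bounded_mfunB bKZ bphiZ) (bounded_mfunZ h bLZ)).
apply: (norm_mean P1); split.
  exact: (bounded_mfunB (bounded_mfunB bKZ bphiZ) (bounded_mfunZ h bLZ)).1.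
move=> w /=; have := ltW (dP h hd0 (Z t w)).
move: (\int[K h _]_y phi y) (phi _) (L phi _) => a b c.
have -> : a - b - h * c = - (h * (c - h^-1 * (a - b))) by field; rewrite gt_eqF.
by rewrite normrN normrM (gtr0_norm h0) [h * _]mulrC ler_pM2r.
Qed.

End markov_generator.

(** * Wild's sum *)

Section weights.
Context (R : realType) (w : nat -> R).
Hypothesis w0 : forall n, 0 <= w n.
Hypothesis w1 : series w @ \oo --> (1 : R).

(** Weights become a law on [nat] so that infinite mixtures are instances of [bind] and
    rearrangements of series follow from Fubini and dominated convergence. *)
Definition weights of (forall n, 0 <= w n) & series w @ \oo --> (1 : R) :
  set nat -> \bar R := mseries (fun n => mscale (NngNum (w0 n)) \d_n) 0.

Let weights1 : weights w0 w1 setT = 1%E.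
Proof.
rewrite /weights/= /mseries/= /mscale/=.
under eq_eseriesr do rewrite diracT mule1.
apply: cvg_lim => //; apply/fine_cvgP; split.
  by apply: nearW => n; rewrite /= sumEFin.
rewrite (_ : _ \o _ = series w) //; apply/funext => n /=.
by rewrite sumEFin.
Qed.

HB.instance Definition _ := Measure.on (weights w0 w1).
HB.instance Definition _ :=
  Measure_isProbability.Build _ _ _ (weights w0 w1) weights1.

Definition weight_probability : probability nat R := weights w0 w1.

Lemma weight_mean B (g : nat -> R) : (forall n, `|g n| <= B) ->
  series (fun n => w n * g n) @ \oo --> \int[weight_probability]_n g n.
Proof.
move=> gB; have bg : bounded_mfun B g by split.
have bB := bounded_mfun_cst nat B.
have W1 := probability_setT weight_probability.
have gB0 n : 0 <= g n + B.
  by rewrite -lerBlDr sub0r; have := gB n; rewrite ler_norml => /andP[].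
pose u n := w n * (g n + B).
have sumu : (\int[weight_probability]_n g n + B)%:E = (\sum_(n <oo) (u n)%:E)%E.
  rewrite -{1}(mean_cst W1 B) -(meanD W1 bg bB) (EFin_mean W1 (bounded_mfunD bg bB)).
  rewrite ge0_integral_measure_series//=; last first.
    by move=> n _; rewrite lee_fin.
  apply: eq_eseriesr => n _; rewrite ge0_integral_mscale//=; last first.
    by move=> m _; rewrite lee_fin.
  by rewrite integral_dirac//= diracT mul1e EFinM.
have cu : series u @ \oo --> \int[weight_probability]_n g n + B.
  have : (\sum_(0 <= i < n) (u i)%:E)%E @[n --> \oo] -->
      (\int[weight_probability]_n g n + B)%:E.
    rewrite sumu; apply: is_cvg_nneseries => n _ _.
    by rewrite lee_fin mulr_ge0.
  move=> /fine_cvgP[_]; rewrite (_ : _ \o _ = series u) //.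
  by apply/funext => n /=; rewrite sumEFin.
rewrite -[X in _ --> X](addrK B) -[X in _ - X]mulr1.
(* The shift by [B] that made the terms nonnegative is removed; the partial sums of the weights tend
   to 1. *)
rewrite (_ : series _ = (fun n => series u n - B * series w n)).
  by apply: cvgB => //; apply: cvgM => //; exact: cvg_cst.
apply/funext => n; rewrite /series/= mulr_sumr -sumrB; apply: eq_bigr => i _.
rewrite /u; ring.
Qed.

Lemma weight_point k : weight_probability [set k] = (w k)%:E.
Proof.
have mk : measurable [set k] by [].
rewrite -(@fineK _ (weight_probability [set k])) ?fin_num_measure//.
congr EFin; rewrite -mean_indic//.
have := @weight_mean 1 \1_[set k].
move=> /(_ _)/cvg_unique-/(_ (@norm_hausdorff _ _)); apply.
  by move=> n; rewrite indicE; case: (_ \in _); rewrite ?normr1 ?normr0.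
apply: cvg_near_cst; exists k.+1 => // n /= kn; apply/eqP.
rewrite /series/= (bigD1_seq k) ?iota_uniq ?mem_index_iota//= indicE.
rewrite mem_set// mulr1 big1 ?addr0// => i ik.
by rewrite indicE memNset ?mulr0//; exact/eqP.
Qed.

End weights.

Section uniform_weights.
Context (R : realType) (n : nat).

Definition uniform_weight k : R := if (k <= n)%N then n.+1%:R^-1 else 0.

Lemma uniform_weight_ge0 k : 0 <= uniform_weight k.
Proof. by rewrite /uniform_weight; case: ifP. Qed.

Lemma uniform_weight_series (g : nat -> R) :
  series (fun k => uniform_weight k * g k) @ \oo -->
  n.+1%:R^-1 * \sum_(k < n.+1) g k.
Proof.
apply: cvg_near_cst; exists n.+1 => // m /= nm; apply/eqP.
rewrite /series/= (big_cat_nat _ nm)//= [X in _ + X == _]big_nat_cond [X in _ + X == _]big1 ?addr0.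
  rewrite big_mkord mulr_sumr; apply/eqP; apply: eq_bigr => i _.
  by rewrite /uniform_weight -ltnS ltn_ord.
by move=> i /andP[/andP[ni _] _]; rewrite /uniform_weight leqNgt ni mul0r.
Qed.

Lemma uniform_weight1 : series uniform_weight @ \oo --> (1 : R).
Proof.
have := @uniform_weight_series (fun=> 1).
rewrite sumr_const card_ord mulVf ?pnatr_eq0//.
by rewrite (_ : (fun k => _) = uniform_weight)//; apply/funext => k; rewrite mulr1.
Qed.

Definition uniform_probability : probability nat R :=
  weight_probability uniform_weight_ge0 uniform_weight1.

Lemma mean_uniform (g : nat -> R) (B : R) : (forall n, `|g n| <= B) ->
  \int[uniform_probability]_k g k = n.+1%:R^-1 * \sum_(k < n.+1) g k.
Proof.
move=> gB; have c1 := @weight_mean _ _ uniform_weight_ge0 uniform_weight1 _ _ gB.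
exact: (cvg_unique (@norm_hausdorff _ _) c1 (@uniform_weight_series g)).
Qed.

End uniform_weights.

(** * Power series with bounded coefficients *)

Section bounded_power_series.
Variable R : realType.
Implicit Types (c : nat -> R) (C r x a : R).

Lemma bernoulli_inequality a n : 0 <= a -> 1 + n%:R * a <= (1 + a) ^+ n.
Proof.
move=> a0; elim: n => [|n ih]; first by rewrite mul0r addr0 expr0.
rewrite exprS; apply: le_trans (ler_wpM2l _ ih); last by rewrite addr_ge0.
rewrite -natr1; have : 0 <= n%:R * a * a by rewrite !mulr_ge0.
by move: (n%:R) => m; lra.
Qed.

Lemma cvg_pseries_geometric c C r x :
  (forall n, `|c n| <= C * r ^+ n) -> 0 <= r -> `|r * x| < 1 -> cvgn (pseries c x).
Proof.
move=> cC r0 rx.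
have C0 : 0 <= C.
  by have := cC 0%N; rewrite expr0 mulr1; apply: le_trans.
apply: normed_cvg; apply: (@series_le_cvg _ _ (geometric C `|r * x|)) => [n|n|n|].
- by rewrite /= normr_ge0.
- by rewrite /geometric /= mulr_ge0// exprn_ge0.
- rewrite /geometric/= normrM normrX (normrM r) exprMn mulrA.
  by rewrite ler_wpM2r ?exprn_ge0// (ger0_norm r0).
- by apply: is_cvg_geometric_series; rewrite normr_id.
Qed.

(** Formal differentiation costs a factor n+1, which Bernoulli's inequality bounds by (1+a)^n / a:
    an arbitrarily small loss on the ratio. *)
Lemma pseries_diffs_geometric c C r a : 0 <= r -> 0 < a <= 1 ->
  (forall n, `|c n| <= C * r ^+ n) ->
  forall n, `|pseries_diffs c n| <= (C * r / a) * (r * (1 + a)) ^+ n.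
Proof.
move=> r0 /andP[a0 a1] cC n; rewrite /pseries_diffs normrM ger0_norm//.
have C0 : 0 <= C.
  by have := cC 0%N; rewrite expr0 mulr1; apply: le_trans.
have na : a * n.+1%:R <= (1 + a) ^+ n.
  apply: le_trans (bernoulli_inequality n (ltW a0)).
  by rewrite -natr1 mulrDr mulr1 addrC mulrC lerD2r.
have -> : C * r / a * (r * (1 + a)) ^+ n = C * r ^+ n.+1 * ((1 + a) ^+ n / a).
  by rewrite exprMn exprS; move: (r ^+ n) ((1 + a) ^+ n) => u v; field; rewrite gt_eqF.
rewrite mulrC; apply: ler_pM => //.
by rewrite ler_pdivlMr// mulrC.
Qed.

Lemma is_derive_bounded_pseries c C x : (forall n, `|c n| <= C) -> `|x| < 1 ->
  is_derive x 1 (fun x => limn (pseries c x)) (limn (pseries (pseries_diffs c) x)).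
Proof.
(* Termwise differentiation at [x] asks for convergence of the series and of its first two formal
   derivatives at some [K] beyond |x|. Each derivative multiplies the ratio by 1 + a, and this [a]
   keeps (1 + a)^2 K below 1. *)
move=> cC x1; pose K := (1 + `|x|) / 2; pose a := (1 - K) / 4.
have x0 : 0 <= `|x| by [].
have K1 : K < 1 by rewrite /K; lra.
have K0 : 0 < K by rewrite /K; lra.
have xK : `|x| < K by rewrite /K; lra.
have a01 : 0 < a <= 1 by rewrite /a; apply/andP; split; lra.
have aK : (1 + a) * (1 + a) * K < 1.
  have a3 : (1 + a) * (1 + a) <= 1 + 3 * a.
    have : 0 <= a * (1 - a) by case/andP: a01 => ? ?; rewrite mulr_ge0 ?subr_ge0// ltW.
    by lra.
  have : (1 + a) * (1 + a) * K <= (1 + 3 * a) * K by rewrite ler_wpM2r// ltW.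
  have : 0 < (1 - K) * (1 - K) by rewrite mulr_gt0// subr_gt0.
  by rewrite /a; lra.
have a0 : 0 <= a by case/andP: a01 => /ltW.
have aK1 : (1 + a) * K < 1.
  apply: le_lt_trans aK; rewrite ler_wpM2r ?(ltW K0)//.
  by rewrite ler_peMl ?lerDl// addr_ge0.
have c0 n : `|c n| <= C * 1 ^+ n by rewrite expr1n mulr1.
have c1 := pseries_diffs_geometric ler01 a01 c0.
have r1 : 0 <= 1 * (1 + a) by rewrite mul1r addr_ge0.
have c2 := pseries_diffs_geometric r1 a01 c1.
apply: (@pseries_snd_diffs _ _ K).
- by apply: (cvg_pseries_geometric c0) => //; rewrite mul1r ger0_norm// ltW.
- apply: (cvg_pseries_geometric c1) => //.
  by rewrite mul1r ger0_norm// mulr_ge0 ?addr_ge0// ltW.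
- apply: (cvg_pseries_geometric c2); first by rewrite mulr_ge0 ?addr_ge0.
  by rewrite mul1r ger0_norm// !mulr_ge0 ?addr_ge0// ltW.
- by rewrite (gtr0_norm K0).
Qed.

End bounded_power_series.

Lemma mean_dirac d (T : measurableType d) (R : realType) (a : T) B (f : T -> R) :
  bounded_mfun B f -> \int[\d_a]_x f x = f a.
Proof.
move=> bf; rewrite /Rintegral integral_dirac//=; last first.
  by apply/measurable_EFinP; exact: bf.1.
by rewrite indicE mem_set// mul1r.
Qed.

Lemma mean_bernoulli (R : realType) (p : R) (g : bool -> R) : 0 <= p <= 1 ->
  \int[bernoulli_prob p]_b g b = p * g true + (1 - p) * g false.
Proof.
move=> p01; pose B := `|g true| + `|g false|.
have bg : bounded_mfun B g.
  by split=> // -[]; rewrite /B ?lerDl ?lerDr.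
have bB := bounded_mfun_cst bool B.
have b1 := @probability_setT _ _ R (bernoulli_prob p).
apply: (addIr B).
rewrite -{1}(mean_cst b1 B) -(meanD b1 bg bB) /Rintegral.
rewrite integral_bernoulli_prob//; last first.
  move=> b; rewrite lee_fin -lerBlDr sub0r.
  by have := bg.2 b; rewrite ler_norml => /andP[].
by rewrite -!EFinM -EFinD /=; rewrite /unstable.onem; ring.
Qed.

Lemma bounded_mfun_section_mean d d' (S : measurableType d) (T : measurableType d')
    (R : realType) (P : probability T R) B (f : S * T -> R) :
  bounded_mfun B f -> bounded_mfun B (fun x => \int[P]_y f (x, y)).
Proof.
apply: (@bounded_mfun_kernel_mean _ _ _ _ _ (fun=> P)) => A mA.
exact: measurable_cst.
Qed.

Lemma measurable_discrete_prod (A : set (nat * nat)) : measurable A.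
Proof.
apply: countable_measurable => [[i j]|]; last exact: countableP.
rewrite (_ : [set (i, j)] = [set i] `*` [set j]); first exact: measurableX.
by apply/seteqP; split=> [_ -> //|[k l] [/= -> ->]].
Qed.

Section wild_sum.
Context (R : realType) (E : completePseudoMetricType R).
Hypothesis hE : polish_space E.
Variables (lam : E * E -> R)
          (Gam : E * E -> probability (borel E * borel E)%type R).
Hypothesis hlam : collision_rate lam.
Hypothesis hGam : post_collisional Gam.
Variable M : R.
Hypothesis M0 : 0 < M.
Hypothesis lamM : forall z, lam z <= M.

Let p z := lam z / M.

Let p01 z : 0 <= p z <= 1.
Proof.
have [lam0 _ _ _] := hlam.
by rewrite /p divr_ge0 ?(ltW M0)//= ler_pdivrMr// mul1r.
Qed.

Definition post_choice (z : borel E * borel E) (b : bool) :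
    probability (borel E) R :=
  if b then [the probability (borel E) R of
               distribution (Gam z) (@fst (borel E) (borel E))]
  else [the probability (borel E) R of @dirac _ (borel E) z.1 R].

Lemma measurable_post_choice z A : measurable A ->
  measurable_fun setT (fun b => post_choice z b A).
Proof. by []. Qed.

(* The collisions are made to occur at the constant rate [M] by adding
   fictitious ones, which leave the particle unchanged. *)
Definition post (z : borel E * borel E) : probability (borel E) R :=
  bind (bernoulli_prob (p z)) (measurable_post_choice z).

Lemma measurable_post A : measurable A ->
  measurable_fun setT (fun z : borel E * borel E => post z A).
Proof.
move=> mA.
rewrite [X in measurable_fun _ X](_ : _ = fun z : borel E * borel E =>
  ((p z)%:E * Gam z (fst @^-1` A) + (1 - p z)%:E * (\1_A z.1)%:E)%E).
  have mp : measurable_fun setT (fun z : borel E * borel E => p z).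
    by apply: measurable_funM => //; exact: measurable_lam.
  apply: emeasurable_funD; apply: emeasurable_funM.
  - exact/measurable_EFinP.
  - apply: (post_collisional_kernel hE hGam).
    by rewrite -[X in measurable X]setTI; exact: measurable_fst.
  - by apply/measurable_EFinP; exact: measurable_funB.
  - apply/measurable_EFinP.
    have mi : measurable_fun setT (\1_A : borel E -> R) by exact: measurable_indic.
    exact: (measurableT_comp mi measurable_fst).
by apply/funext => z; rewrite bindE integral_bernoulli_prob.
Qed.

Lemma mean_post z B (phi : E -> R) : bounded_mfun B (phi : borel E -> R) ->
  \int[post z]_x phi x =
  p z * \int[Gam z]_z' phi z'.1 + (1 - p z) * phi z.1.
Proof.
move=> bphi; rewrite (mean_bind _ _ bphi) mean_bernoulli//; congr (_ * _ + _ * _).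
  exact: (mean_pushforward _ _ bphi).
exact: (mean_dirac _ bphi).
Qed.

(** Fictitious collisions leave the generator unchanged, but the loss term now has the constant rate
    [M], which the exponential prefactor of Wild's sum absorbs. *)
Lemma L2_fst B (phi : E -> R) z : bounded_mfun B (phi : borel E -> R) ->
  L2 lam Gam (fun p => phi p.1) z = M * (\int[post z]_x phi x - phi z.1).
Proof.
move=> bphi; rewrite (mean_post z bphi).
have bphi1 : bounded_mfun B ((fun p => phi p.1) : borel E * borel E -> R).
  exact: (bounded_mfun_comp measurable_fst bphi).
by rewrite (L2E lam Gam z bphi1) /p; field; rewrite gt_eqF.
Qed.

Lemma bounded_mfun_post B (phi : E -> R) : bounded_mfun B (phi : borel E -> R) ->
  bounded_mfun B
    ((fun z => \int[post z]_x phi x) : borel E * borel E -> R).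
Proof.
move=> bphi; apply: (bounded_mfun_kernel_mean measurable_post (f := phi \o snd)).
exact: (bounded_mfun_comp measurable_snd bphi).
Qed.

Definition collision_product (mu nu : probability (borel E) R) :
    probability (borel E) R :=
  bind (product_probability mu nu) measurable_post.

Variable f0 : probability (borel E) R.

Let mnat (P : nat -> probability (borel E) R) A : measurable A ->
  measurable_fun setT (fun n => P n A).
Proof. by []. Qed.

(** Wild's recursion refers to all earlier terms. [wild_upto n] is a table meaningful at indices up
    to [n] only, which makes the recursion structural. *)
Fixpoint wild_upto n : nat -> probability (borel E) R :=
  if n is n'.+1 then fun k =>
    if (k <= n')%N then wild_upto n' k
    else bind (uniform_probability R n')
           (@mnat (fun i => collision_product (wild_upto n' i) (wild_upto n' (n' - i))))
  else fun=> f0.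

Definition wild n := wild_upto n n.

Lemma wild_uptoE n k : (k <= n)%N -> wild_upto n k = wild k.
Proof.
elim: n => [|n ih]; first by rewrite leqn0 => /eqP ->.
rewrite leq_eqVlt ltnS => /orP[/eqP -> //|kn].
by rewrite /= kn ih.
Qed.

Lemma mean_wildS n B (phi : E -> R) : bounded_mfun B (phi : borel E -> R) ->
  \int[wild n.+1]_x phi x = n.+1%:R^-1 * \sum_(i < n.+1)
    \int[product_probability (wild i) (wild (n - i))]_z \int[post z]_x phi x.
Proof.
move=> bphi; rewrite /wild /= ltnn (mean_bind _ _ bphi).
rewrite (@mean_uniform _ _ _ B); last first.
  by move=> k; apply: (norm_mean (probability_setT _) bphi).
congr (_ * _); apply: eq_bigr => i _.
rewrite (mean_bind _ _ bphi) !wild_uptoE//; first exact: leq_subr.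
by rewrite -ltnS.
Qed.

Section generating_function.
Variable x : R.
Hypothesis x01 : 0 <= x < 1.

Definition geometric_weight k := (1 - x) * x ^+ k.

Lemma geometric_weight_ge0 k : 0 <= geometric_weight k.
Proof.
by have /andP[x0 x1] := x01; rewrite mulr_ge0 ?exprn_ge0// subr_ge0 ltW.
Qed.

Lemma geometric_weight1 : series geometric_weight @ \oo --> (1 : R).
Proof.
have /andP[x0 x1] := x01.
have := @cvg_geometric_series _ (1 - x) x.
rewrite ger0_norm// => /(_ x1); rewrite divff//.
by rewrite gt_eqF// subr_gt0.
Qed.

Let W := weight_probability geometric_weight_ge0 geometric_weight1.

Definition wild_mixture : probability (borel E) R := bind W (@mnat wild).

Lemma mean_wild_mixture B (phi : E -> R) : bounded_mfun B (phi : borel E -> R) ->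
  pseries (fun n => \int[wild n]_y phi y) x @ \oo -->
    (1 - x)^-1 * \int[wild_mixture]_y phi y.
Proof.
move=> bphi; have /andP[x0 x1] := x01; have x1n : 1 - x != 0 by rewrite gt_eqF// subr_gt0.
rewrite (mean_bind _ _ bphi).
have := @weight_mean _ _ geometric_weight_ge0 geometric_weight1 B
  (fun n => \int[wild n]_y phi y).
move=> /(_ (fun n => norm_mean (probability_setT _) bphi)) H.
rewrite (_ : pseries _ x = (fun n => (1 - x)^-1 *
    series (fun n => geometric_weight n * \int[wild n]_y phi y) n)).
  by apply: cvgM => //; exact: cvg_cst.
apply/funext => n; rewrite /pseries /series /= mulr_sumr; apply: eq_bigr => i _.
by rewrite /geometric_weight mulrA mulrA mulVf// mul1r mulrC.
Qed.

(* The triangular partial sums are integrals, with respect to the product of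
   two geometric laws, of a pointwise convergent sequence. *)
Lemma wild_mixture_product B (psi : E * E -> R) :
  bounded_mfun B (psi : borel E * borel E -> R) ->
  pseries (fun n => \sum_(i < n.+1)
      \int[product_probability (wild i) (wild (n - i))]_z psi z) x @ \oo -->
    (1 - x)^-2 * \int[product_probability wild_mixture wild_mixture]_z psi z.
Proof.
move=> bpsi; have /andP[x0 x1] := x01; have x1n : 1 - x != 0 by rewrite gt_eqF// subr_gt0.
pose a i j := \int[product_probability (wild i) (wild j)]_z psi z.
have aB i j : `|a i j| <= B.
  exact: (norm_mean (probability_setT (product_probability (wild i) (wild j))) bpsi).
have B0 : 0 <= B by exact: le_trans (aB 0%N 0%N).
have WW1 := probability_setT (product_probability W W).
have bnat (C : R) (g : nat * nat -> R) : (forall u, `|g u| <= C) -> bounded_mfun C g.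
  by move=> gC; split=> // _ Y mY; exact: measurable_discrete_prod.
have -> : \int[product_probability wild_mixture wild_mixture]_z psi z =
    \int[product_probability W W]_u a u.1 u.2.
  have bmix := bounded_mfun_section_mean wild_mixture bpsi.
  have ba : bounded_mfun B (fun u => a u.1 u.2) by apply: bnat => -[i j] /=.
  rewrite (mean_product12 _ _ bpsi) (mean_bind _ _ bmix) (mean_product12 _ _ ba).
  apply: eq_Rintegral => i _ /=.
  have bi : bounded_mfun B
      ((fun v => \int[wild i]_y psi (y, v)) : borel E -> R).
    have bsw : bounded_mfun B
        ((fun q => psi (q.2, q.1)) : borel E * borel E -> R).
      exact: (bounded_mfun_comp (@measurable_swap _ _ (borel E) (borel E)) bpsi).
    exact: (bounded_mfun_section_mean (wild i) bsw).
  rewrite -(mean_product12 (wild i) wild_mixture bpsi).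
  rewrite (mean_product21 (wild i) wild_mixture bpsi) (mean_bind _ _ bi).
  by apply: eq_Rintegral => j _; rewrite /a (mean_product21 _ _ bpsi).
(* [g n] is [a] restricted to the triangle k + l < n, written diagonal by diagonal: on the diagonal
   [m] the product of the two geometric weights is (1 - x)^2 x^m, as in the power series. *)
pose g n (u : nat * nat) := \sum_(m < n) \sum_(i < m.+1)
  a i (m - i)%N * \1_[set ((i : nat), (m - i)%N)] u.
have gE n k l : g n (k, l) = if (k + l < n)%N then a k l else 0.
  transitivity (\sum_(m < n | m == (k + l)%N :> nat) a k l); last first.
    exact: (@big_ord1_eq _ _ _ (fun=> a k l)).
  rewrite [RHS]big_mkcond /g.
  apply: eq_bigr => m _.
  rewrite (eq_bigr (fun i : 'I_m.+1 => if (i : nat) == k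
      then a k (m - k)%N * ((m - k)%N == l)%:R else 0)); last first.
    move=> i _; rewrite indicE; case: eqP => [->|ik].
      congr (_ * _); congr (_%:R); congr nat_of_bool.
      apply/idP/eqP => [|->]; last by rewrite inE.
      by rewrite inE => -[].
    by rewrite memNset ?mulr0// => -[/esym].
  rewrite -big_mkcond /=.
  transitivity (if (k < m.+1)%N then a k (m - k)%N * ((m - k)%N == l)%:R else 0).
    exact: (@big_ord1_eq _ _ _ (fun=> a k (m - k)%N * ((m - k)%N == l)%:R)).
  rewrite ltnS; case: leqP => [km|mk].
    case: (eqVneq (m - k)%N l) => [<-|ml].
      by rewrite subnKC// eqxx mulr1.
    rewrite mulr0; case: eqP => // mkl; move: ml.
    by rewrite mkl addKn eqxx.
  by case: eqP => // mkl; move: mk; rewrite mkl ltnNge leq_addr.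
have gB n : bounded_mfun B (g n).
  by apply: bnat => -[k l]; rewrite gE; case: ifP => _; rewrite ?normr0.
have gl u : g n u @[n --> \oo] --> a u.1 u.2.
  case: u => k l /=; apply: cvg_near_cst; exists (k + l).+1 => // n /= kln.
  by apply/eqP; rewrite gE kln.
have H := mean_dominated_cvg WW1 gB gl.
rewrite (_ : pseries _ x = (fun n => (1 - x)^-2 *
    \int[product_probability W W]_u g n u)).
  by apply: cvgM => //; exact: cvg_cst.
apply/funext => n.
have bterm (i j : nat) : bounded_mfun B (fun u => a i j * \1_[set (i, j)] u).
  apply: bnat => u; rewrite normrM indicE.
  by case: (_ \in _); rewrite ?normr1 ?normr0 ?mulr1 ?mulr0.
have bind1 (i j : nat) : bounded_mfun 1 (\1_[set (i, j)] : nat * nat -> R).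
  apply: bnat => u; rewrite indicE.
  by case: (_ \in _); rewrite ?normr1 ?normr0.
have bsum m : bounded_mfun (\sum_(i < m.+1) B)
    (fun u => \sum_(i < m.+1) a i (m - i)%N * \1_[set ((i : nat), (m - i)%N)] u).
  by apply: bounded_mfun_sum => i; exact: bterm.
have point (i j : nat) : \int[product_probability W W]_u \1_[set (i, j)] u =
    (1 - x) * x ^+ i * ((1 - x) * x ^+ j).
  rewrite mean_indic; last exact: measurable_discrete_prod.
  rewrite (_ : [set (i, j)] = [set i] `*` [set j]); last first.
    by apply/seteqP; split=> [_ -> //|[k l] [/= -> ->]].
  rewrite [X in fine X](_ : _ = (W [set i] * W [set j])%E).
    by rewrite /W !weight_point.
  exact: product_measure1E.
have meang : \int[product_probability W W]_u g n u =
    \sum_(m < n) \sum_(i < m.+1) a i (m - i)%N * ((1 - x) ^+ 2 * x ^+ m).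
  pose C := \sum_(m < n) \sum_(i < m.+1) B.
  rewrite (@mean_sum _ _ _ _ WW1 _ _ _ C); last first.
    move=> m; apply: bounded_mfunW (bsum m).
    by rewrite /C (bigD1 m)//= lerDl sumr_ge0// => m' _; rewrite sumr_ge0.
  apply: eq_bigr => m _; rewrite (@mean_sum _ _ _ _ WW1 _ _ _ B); last first.
    by move=> i; exact: bterm.
  apply: eq_bigr => i _; rewrite (meanZ WW1 _ (bind1 _ _)) point.
  have im : (i <= m)%N by rewrite -ltnS.
  have -> : x ^+ m = x ^+ i * x ^+ (m - i) by rewrite -exprD subnKC.
  by congr (_ * _); ring.
rewrite meang /pseries /series /= big_mkord mulr_sumr; apply: eq_bigr => m _.
rewrite mulr_suml mulr_sumr; apply: eq_bigr => i _.
by rewrite -/(a i (m - i)%N); move: (a _ _) (x ^+ m) => u v; field.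
Qed.

End generating_function.

(** Clipping at 0 puts 1 - [decay t] in [0, 1) for every real t, so that the mixture is a
    probability law at all times. *)
Definition decay t := expR (- M * Num.max t 0).

Lemma decay_range t : 0 <= 1 - decay t < 1.
Proof.
rewrite subr_ge0 ltrBlDr ltrDl expR_gt0 andbT /decay -expR0 ler_expR mulNr oppr_le0.
by rewrite mulr_ge0 ?(ltW M0)// le_max lexx orbT.
Qed.

(** The case distinction gives [flow 0 = f0] as an equality of probabilities; the mixture at time 0
    is compared with [f0] through means only. *)
Definition flow t : probability (borel E) R :=
  if 0 < t then wild_mixture (decay_range t) else f0.

Lemma flow0 : flow 0 = f0. Proof. by rewrite /flow ltxx. Qed.

Let decayE (t : R) : 0 <= t -> decay t = expR (- M * t).
Proof. by move=> t0; rewrite /decay max_l. Qed.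

Lemma mean_flow_mixture (t : R) B (phi : E -> R) : 0 <= t ->
  bounded_mfun B (phi : borel E -> R) ->
  \int[flow t]_x phi x = \int[wild_mixture (decay_range t)]_x phi x.
Proof.
move=> t0 bphi; rewrite /flow; case: ltP => // tle0.
have {t0 tle0} -> : t = 0 by apply/eqP; rewrite eq_le tle0.
have := @mean_wild_mixture _ (decay_range 0) _ _ bphi.
move: (wild_mixture (decay_range 0)) => m.
have -> : 1 - decay 0 = 0 by rewrite decayE// mulr0 expR0 subrr.
rewrite subr0 invr1 mul1r => H.
apply: (cvg_unique (@norm_hausdorff _ _)) H.
apply: cvg_near_cst; exists 1%N => // -[//|n] _; apply/eqP.
rewrite /pseries /series /= big_nat_recl//= expr0 mulr1 big1_seq ?addr0//.
by move=> i _; rewrite expr0n mulr0.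
Qed.

Lemma mean_flow2_mixture (t : R) B (psi : E * E -> R) : 0 <= t ->
  bounded_mfun B (psi : borel E * borel E -> R) ->
  \int[product_probability (flow t) (flow t)]_z psi z =
  \int[product_probability (wild_mixture (decay_range t))
                           (wild_mixture (decay_range t))]_z psi z.
Proof.
move=> t0 bpsi; have bsec := bounded_mfun_section_mean (flow t) bpsi.
rewrite !(mean_product12 _ _ bpsi) (mean_flow_mixture t0 bsec).
apply: eq_Rintegral => x _; apply: (mean_flow_mixture t0 (B := B)).
exact: (bounded_mfun_comp (pair1_measurable x) bpsi).
Qed.

(** Without clipping, this formula is differentiable across 0, which gives a meaning to the
    two-sided derivative there. *)
Definition flow_series (phi : E -> R) t :=
  expR (- M * t) * limn (pseries (fun n => \int[wild n]_x phi x) (1 - expR (- M * t))).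

Lemma mean_flow (t : R) B (phi : E -> R) : 0 <= t ->
  bounded_mfun B (phi : borel E -> R) -> \int[flow t]_x phi x = flow_series phi t.
Proof.
move=> t0 bphi; rewrite (mean_flow_mixture t0 bphi) /flow_series -(decayE t0).
rewrite (cvg_lim (@norm_hausdorff _ _) (@mean_wild_mixture _ (decay_range t) _ _ bphi)).
move: (wild_mixture _) => m.
by rewrite subKr mulVKf// /decay gt_eqF// expR_gt0.
Qed.

(** Wild's recursion says that the generating series satisfies G' = G o G, since the factor n+1 of
    the derivative cancels the average. As F = e^(-Mt) G(1 - e^(-Mt)), the chain rule gives the gain
    term M (F o F), and the derivative of the prefactor gives the loss term -M F. *)
Lemma is_derive_flow_series (t : R) B (phi : E -> R) : 0 <= t ->
  bounded_mfun B (phi : borel E -> R) ->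
  is_derive t 1 (flow_series phi)
    (\int[product_probability (flow t) (flow t)]_z
        L2 lam Gam (fun p => phi p.1) z).
Proof.
move=> t0 bphi.
pose q n := \int[wild n]_x phi x.
pose G x := limn (pseries q x).
pose e u := expR (- M * u).
have qB n : `|q n| <= B by exact: (norm_mean (probability_setT (wild n)) bphi).
have e01 : 0 <= 1 - e t < 1 by rewrite /e -(decayE t0) decay_range.
have et0 : e t != 0 by rewrite /e gt_eqF// expR_gt0.
have bpost := bounded_mfun_post bphi.
have dG : is_derive (1 - e t) 1 G (limn (pseries (pseries_diffs q) (1 - e t))).
  apply: (is_derive_bounded_pseries qB).
  by have /andP[x0 x1] := e01; rewrite ger0_norm.
have diffsE : pseries_diffs q = (fun n => \sum_(i < n.+1)
    \int[product_probability (wild i) (wild (n - i))]_z \int[post z]_x phi x).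
  apply/funext => n; rewrite /pseries_diffs /q (mean_wildS n bphi).
  by rewrite mulVKf// pnatr_eq0.
have limG' : limn (pseries (pseries_diffs q) (1 - e t)) =
    (e t)^-2 * \int[product_probability (flow t) (flow t)]_z \int[post z]_x phi x.
  rewrite diffsE (mean_flow2_mixture t0 bpost).
  have := @wild_mixture_product _ (decay_range t) _ _ bpost.
  move: (product_probability (wild_mixture _) _) => m.
  rewrite decayE// -/(e t) => H.
  by rewrite (cvg_lim (@norm_hausdorff _ _) H) subKr.
have de : is_derive t 1 e (- M * e t).
  rewrite /e mulrC; apply: (@is_derive1_comp _ expR (fun u => - M * u)).
  have := is_deriveZ (- M) (is_derive_id t (1 : R)).
  by rewrite /GRing.scale /= mulr1.
have d1e : is_derive t 1 (fun u => 1 - e u) (M * e t).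
  have := is_deriveB (is_derive_cst (1 : R) t (1 : R)) de.
  by rewrite sub0r mulNr opprK.
have dGe := @is_derive1_comp _ G (fun u => 1 - e u) t _ _ dG d1e.
have dF := is_deriveM de dGe.
have -> : flow_series phi = e * (G \o (fun u => 1 - e u)) by [].
apply: (is_derive_eq dF).
have mean1 : G (1 - e t) = (e t)^-1 * \int[flow t]_x phi x.
  by rewrite (mean_flow t0 bphi) /flow_series -/(e t) mulKf.
rewrite /= limG' mean1 /GRing.scale /=.
have FF1 := probability_setT (product_probability (flow t) (flow t)).
have bfst : bounded_mfun B ((fun z => phi z.1) : borel E * borel E -> R).
  exact: (bounded_mfun_comp measurable_fst bphi).
have -> : \int[product_probability (flow t) (flow t)]_z L2 lam Gam (fun p => phi p.1) z =
    M * (\int[product_probability (flow t) (flow t)]_z \int[post z]_x phi x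
         - \int[flow t]_x phi x).
  have -> : \int[flow t]_x phi x =
      \int[product_probability (flow t) (flow t)]_z phi z.1.
    rewrite (mean_product12 _ _ bfst); apply: eq_Rintegral => x _ /=.
    by rewrite (mean_cst (probability_setT (flow t))).
  rewrite -(meanB FF1 bpost bfst) -(meanZ FF1 M (bounded_mfunB bpost bfst)).
  by apply: eq_Rintegral => z _; exact: (L2_fst z bphi).
set u := Rintegral (product_probability _ _) _ _; set v := Rintegral (flow t) _ _.
by move: (e t) et0 => w w0; field.
Qed.

End wild_sum.

(** * Tensor powers of the solution *)

Section tuple_cons_lemmas.
Context d (T : measurableType d).
Implicit Types (x u : T).

Lemma tnth_tuple_cons n x (z : n.-tuple T) i :
  tnth (tuple_cons (x, z)) (lift ord0 i) = tnth z i.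
Proof. exact: tnthS. Qed.

Lemma select_tuple_cons n x (z : n.-tuple T) :
  select (lift ord0) (tuple_cons (x, z)) = z.
Proof. by apply: eq_from_tnth => i; rewrite tnth_mktuple tnth_tuple_cons. Qed.

Lemma set_coord_tuple_cons0 n x (z : n.-tuple T) u :
  set_coord (tuple_cons (x, z)) ord0 u = tuple_cons (u, z).
Proof.
apply: eq_from_tnth => i; rewrite tnth_mktuple.
by case: (unliftP ord0 i) => [j|] ->; rewrite ?tnth_tuple_cons.
Qed.

Lemma set_coord_tuple_cons n x (z : n.-tuple T) a u :
  set_coord (tuple_cons (x, z)) (lift ord0 a) u = tuple_cons (x, set_coord z a u).
Proof.
apply: eq_from_tnth => i; rewrite tnth_mktuple.
case: (unliftP ord0 i) => [j|] ->; rewrite ?tnth_tuple_cons ?tnth_mktuple//.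
Qed.

End tuple_cons_lemmas.

Section tensor_mean.
Context d (T : measurableType d) (R : realType).

Lemma bounded_mfun_tuple_cons n B (f : n.+1.-tuple T -> R) :
  bounded_mfun B f -> bounded_mfun B (fun q : T * n.-tuple T => f (tuple_cons q)).
Proof. exact: (bounded_mfun_comp (@measurable_tuple_cons _ T n)). Qed.

Lemma mean_tensorS (mu : probability T R) n B (f : n.+1.-tuple T -> R) :
  bounded_mfun B f ->
  \int[tensor_power mu n.+1]_y f y =
  \int[mu]_x \int[tensor_power mu n]_z f (tuple_cons (x, z)).
Proof.
move=> bf; rewrite /= (mean_pushforward _ _ bf).
exact: (mean_product12 mu (tensor_power mu n) (bounded_mfun_tuple_cons bf)).
Qed.

End tensor_mean.

Section tensor_hierarchy.
Context (R : realType) (E : completePseudoMetricType R).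
Hypothesis hE : polish_space E.
Variables (lam : E * E -> R)
          (Gam : E * E -> probability (borel E * borel E)%type R).
Hypothesis hlam : collision_rate lam.
Hypothesis hGam : post_collisional Gam.
Variable M : R.
Hypothesis lamM : forall z, lam z <= M.

Lemma mean_L2 d (X : measurableType d) (mu : probability X R) B
    (G : X -> E * E -> R) u :
  bounded_mfun B (fun p : X * (borel E * borel E) => G p.1 p.2) ->
  \int[mu]_x L2 lam Gam (G x) u = L2 lam Gam (fun p => \int[mu]_x G x p) u.
Proof.
move=> bG.
have bGx x : bounded_mfun B (G x : borel E * borel E -> R).
  exact: (bounded_mfun_comp (pair1_measurable x) bG).
have bGu v : bounded_mfun B (fun x => G x v).
  exact: (bounded_mfun_comp (@pair2_measurable _ _ X (borel E * borel E)%type v) bG).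
have bsw : bounded_mfun B (fun q : (borel E * borel E) * X => G q.2 q.1).
  exact: (bounded_mfun_comp (@measurable_swap _ _ (borel E * borel E)%type X) bG).
have bmG := bounded_mfun_section_mean mu bsw.
have bGamG : bounded_mfun B (fun x => \int[Gam u]_z G x z).
  exact: (bounded_mfun_section_mean (Gam u) bG).
have mu1 := probability_setT mu.
rewrite (L2E lam Gam u bmG) -(mean_product12 (Gam u) mu bsw).
rewrite (mean_product21 (Gam u) mu bsw).
rewrite -(meanB mu1 bGamG (bGu u)) -(meanZ mu1 _ (bounded_mfunB bGamG (bGu u))).
by apply: eq_Rintegral => x _; rewrite (L2E lam Gam u (bGx x)).
Qed.

Variables (n : nat) (phi : n.+1.-tuple E -> R) (B : R).
Hypothesis bphi : bounded_mfun B (phi : n.+1.-tuple (borel E) -> R).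

Let phix (x : E) (z : n.-tuple E) := phi (tuple_cons (x : borel E, z)).

Lemma bounded_mfun_hierarchy_cons :
  bounded_mfun (n%:R * (M * (2 * B)))
    (fun q : borel E * n.+1.-tuple (borel E) => hierarchy lam Gam (phix q.1) q.2).
Proof.
have bc a : bounded_mfun (M * (2 * B)) (fun q : borel E * n.+1.-tuple (borel E) =>
    collide lam Gam (phix q.1) a q.2).
  apply: (@bounded_mfun_L2_param _ _ hE _ _ hlam hGam _ lamM _
    (borel E * n.+1.-tuple (borel E))%type B
    (fun q p => phix q.1 (set_coord (select (lift ord0) q.2) a p.1))
    (fun q => (tnth q.2 (lift ord0 a), tnth q.2 ord0))).
    have mc : measurable_fun setT (fun q :
        (borel E * n.+1.-tuple (borel E)) * (borel E * borel E) =>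
        tuple_cons (q.1.1, set_coord (select (lift ord0) q.1.2) a q.2.1)).
      apply: (measurableT_comp (@measurable_tuple_cons _ (borel E) n)).
      apply: measurable_fun_pair.
        exact: (measurableT_comp measurable_fst measurable_fst).
      apply: measurable_set_coord.
        apply: (measurableT_comp (measurable_select (lift ord0))).
        exact: (measurableT_comp measurable_snd measurable_fst).
      exact: (measurableT_comp measurable_fst measurable_snd).
    exact: (bounded_mfun_comp mc bphi).
  apply: measurable_fun_pair.
    exact: (measurableT_comp (measurable_tnth _) measurable_snd).
  exact: (measurableT_comp (measurable_tnth _) measurable_snd).
have := bounded_mfun_sum (index_enum 'I_n) xpredT bc.
by rewrite sumr_const card_ord -[_ *+ n]mulr_natl.
Qed.

(** The additional particle [w] meets either the first particle [x] or one of the particles of [z],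
    in which case [x] is a mere parameter. *)
Lemma hierarchy_tuple_cons (w x : borel E) (z : n.-tuple (borel E)) :
  hierarchy lam Gam phi (tuple_cons (w, tuple_cons (x, z))) =
  L2 lam Gam (fun p => phix p.1 z) (x, w) +
  hierarchy lam Gam (phix x) (tuple_cons (w, z)).
Proof.
rewrite /hierarchy big_ord_recl; congr (_ + _).
  rewrite /collide (@select_tuple_cons _ (borel E)) (@tnth_tuple_cons _ (borel E)).
  congr (L2 lam Gam _ _); apply/funext => p.
  by rewrite (@set_coord_tuple_cons0 _ (borel E)).
apply: eq_bigr => a _; rewrite /collide !(@select_tuple_cons _ (borel E)).
congr (L2 lam Gam _ _); last by rewrite !(@tnth_tuple_cons _ (borel E)).
by apply/funext => p; rewrite (@set_coord_tuple_cons _ (borel E)).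
Qed.

(** Leibniz rule for a tensor power split into its first factor and the rest: the Boltzmann rate of
    the averaged section, plus the hierarchy of each section. It feeds the induction of
    [tensor_quadratic]. *)
Lemma mean_tensor_hierarchy (mu : probability (borel E) R) :
  \int[tensor_power mu n.+2]_y hierarchy lam Gam phi y =
  \int[product_probability mu mu]_u
     L2 lam Gam (fun p => \int[tensor_power mu n]_z phix p.1 z) u +
  \int[mu]_x \int[tensor_power mu n.+1]_y hierarchy lam Gam (phix x) y.
Proof.
have bh := bounded_mfun_hierarchy hE hlam hGam lamM bphi.
have bhw w : bounded_mfun (n.+1%:R * (M * (2 * B)))
    ((fun v => hierarchy lam Gam phi (tuple_cons (w, v))) :
       n.+1.-tuple (borel E) -> R).
  exact: (bounded_mfun_comp (pair1_measurable w) (bounded_mfun_tuple_cons bh)).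
rewrite (mean_tensorS mu bh).
transitivity (\int[mu]_w \int[mu]_x \int[tensor_power mu n]_z
    hierarchy lam Gam phi (tuple_cons (w, tuple_cons (x, z)))).
  by apply: eq_Rintegral => w _; exact: (mean_tensorS mu (bhw w)).
pose nu := tensor_power mu n; have nu1 := probability_setT nu.
have bJ1 := bounded_mfun_hierarchy_cons.
have bJ1c : bounded_mfun (n%:R * (M * (2 * B)))
    (fun q : (borel E * borel E) * n.-tuple (borel E) =>
      hierarchy lam Gam (phix q.1.1) (tuple_cons (q.1.2, q.2))).
  have mc : measurable_fun setT (fun q : (borel E * borel E) * n.-tuple (borel E) =>
      (q.1.1, tuple_cons (q.1.2, q.2))).
    apply: measurable_fun_pair.
      exact: (measurableT_comp measurable_fst measurable_fst).
    apply: (measurableT_comp (@measurable_tuple_cons _ (borel E) n)).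
    apply: measurable_fun_pair; last exact: measurable_snd.
    exact: (measurableT_comp measurable_snd measurable_fst).
  exact: (bounded_mfun_comp mc bJ1).
have bG : bounded_mfun B (fun q : n.-tuple (borel E) * (borel E * borel E) =>
    phix q.2.1 q.1).
  have mc : measurable_fun setT (fun q : n.-tuple (borel E) * (borel E * borel E) =>
      tuple_cons (q.2.1, q.1)).
    apply: (measurableT_comp (@measurable_tuple_cons _ (borel E) n)).
    apply: measurable_fun_pair; last exact: measurable_fst.
    exact: (measurableT_comp measurable_fst measurable_snd).
  exact: (bounded_mfun_comp mc bphi).
have bJ2 : bounded_mfun (M * (2 * B))
    (fun q : (borel E * borel E) * n.-tuple (borel E) =>
      L2 lam Gam (fun p => phix p.1 q.2) q.1).
  apply: (@bounded_mfun_L2_param _ _ hE _ _ hlam hGam _ lamM _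
    ((borel E * borel E) * n.-tuple (borel E))%type B
    (fun q p => phix p.1 q.2) (fun q => q.1)); last exact: measurable_fst.
  have mc : measurable_fun setT (fun q :
      ((borel E * borel E) * n.-tuple (borel E)) * (borel E * borel E) =>
      (q.1.2, q.2)).
    apply: measurable_fun_pair; last exact: measurable_snd.
    exact: (measurableT_comp measurable_snd measurable_fst).
  exact: (bounded_mfun_comp mc bG).
have bm1 := bounded_mfun_section_mean nu bJ1c.
have bm2 := bounded_mfun_section_mean nu bJ2.
transitivity (\int[product_probability mu mu]_u
   (\int[nu]_z L2 lam Gam (fun p => phix p.1 z) u +
    \int[nu]_z hierarchy lam Gam (phix u.1) (tuple_cons (u.2, z)))).
  rewrite (mean_product21 _ _ (bounded_mfunD bm2 bm1)).
  apply: eq_Rintegral => w _; apply: eq_Rintegral => x _ /=.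
  rewrite -(meanD nu1 (bounded_mfun_comp (pair1_measurable (x, w)) bJ2)
                      (bounded_mfun_comp (pair1_measurable (x, w)) bJ1c)).
  by apply: eq_Rintegral => z _; rewrite hierarchy_tuple_cons.
rewrite (meanD (probability_setT _) bm2 bm1); congr (_ + _).
  apply: eq_Rintegral => u _.
  exact: (@mean_L2 _ _ nu B (fun z p => phix p.1 z)).
rewrite (mean_product12 _ _ bm1); apply: eq_Rintegral => x _ /=.
by rewrite (mean_tensorS mu (bounded_mfun_comp (pair1_measurable x) bJ1)).
Qed.

End tensor_hierarchy.

(** * Second-order estimates in time for the solution and its tensor powers *)

Section boltzmann_flow.
Context (R : realType) (E : completePseudoMetricType R).
Hypothesis hE : polish_space E.
Variables (lam : E * E -> R)
          (Gam : E * E -> probability (borel E * borel E)%type R).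
Hypothesis hlam : collision_rate lam.
Hypothesis hGam : post_collisional Gam.
Variable M : R.
Hypothesis M0 : 0 < M.
Hypothesis lamM : forall z, lam z <= M.
Variable F : R -> probability (borel E) R.

Local Notation rate phi t := (\int[product_probability (F t) (F t)]_z
  L2 lam Gam (fun p => phi p.1) z).

(* F t is only constrained for 0 <= t, so the derivative at 0 is that of an extension
   f of t |-> <F t, phi>. *)
Definition strong_solution := forall (phi : E -> R) (B : R),
  bounded_mfun B (phi : borel E -> R) ->
  exists2 f : R -> R, forall t : R, 0 <= t -> \int[F t]_x phi x = f t &
    forall t : R, 0 <= t -> is_derive t 1 f (rate phi t).

Hypothesis hF : strong_solution.

Lemma bounded_mfun_L2_fst (phi : E -> R) (B : R) : bounded_mfun B (phi : borel E -> R) ->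
  bounded_mfun (M * (2 * B))
    ((fun z => L2 lam Gam (fun p => phi p.1) z) : borel E * borel E -> R).
Proof.
move=> bphi; apply: (@bounded_mfun_L2_param _ _ hE _ _ hlam hGam _ lamM _
  (borel E * borel E)%type B (fun _ p => phi p.1) id) => //.
exact: (bounded_mfun_comp (measurableT_comp measurable_fst measurable_snd) bphi).
Qed.

Let norm_rate (phi : E -> R) (B t : R) : bounded_mfun B (phi : borel E -> R) ->
  `|rate phi t| <= M * (2 * B).
Proof.
by move=> bphi; exact: (norm_mean (probability_setT _) (bounded_mfun_L2_fst bphi)).
Qed.

(** The mean value theorem stands in for an integral of the rate over time and asks only for its
    existence at each time. *)
Lemma flow_mean_value (phi : E -> R) (B s h : R) : bounded_mfun B (phi : borel E -> R) ->
  0 <= s -> 0 <= h -> exists2 c, s <= c <= s + h &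
    \int[F (s + h)]_x phi x - \int[F s]_x phi x = h * rate phi c.
Proof.
move=> bphi s0 h0; have [f fE df] := hF bphi.
have sh : s <= s + h by rewrite lerDl.
have [||c] := @MVT_segment _ f (fun t => rate phi t) s (s + h) sh.
- move=> x; rewrite in_itv/= => /andP[sx _]; apply: df.
  exact: le_trans (ltW sx).
- apply: derivable_within_continuous => x; rewrite in_itv/= => /andP[sx _].
  by have [] := df x (le_trans s0 sx).
rewrite in_itv/= => cs H; exists c => //.
by rewrite (fE s s0) (fE _ (addr_ge0 s0 h0)) H mulrC; congr (_ * _); ring.
Qed.

Lemma flow_lipschitz (phi : E -> R) (B s t : R) : bounded_mfun B (phi : borel E -> R) ->
  0 <= s <= t ->
  `|\int[F t]_x phi x - \int[F s]_x phi x| <= (t - s) * (M * (2 * B)).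
Proof.
move=> bphi /andP[s0 st]; have h0 : 0 <= t - s by rewrite subr_ge0.
have [c _] := flow_mean_value bphi s0 h0.
rewrite (addrC s) subrK => ->; rewrite normrM ger0_norm// ler_wpM2l//.
exact: norm_rate.
Qed.

(** The two factors are changed one at a time, through the mixed product of [F s] and [F t]; each
    change costs one use of [flow_lipschitz] on a partial mean. *)
Lemma flow2_lipschitz (psi : E * E -> R) (B s t : R) :
  bounded_mfun B (psi : borel E * borel E -> R) -> 0 <= s <= t ->
  `|\int[product_probability (F t) (F t)]_z psi z -
    \int[product_probability (F s) (F s)]_z psi z|
  <= (t - s) * (2 * (M * (2 * B))).
Proof.
move=> bpsi st.
rewrite (mean_product12 (F t) _ bpsi) (mean_product21 (F s) _ bpsi).
have bt := bounded_mfun_section_mean (F t) bpsi.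
have bsw : bounded_mfun B ((fun q => psi (q.2, q.1)) : borel E * borel E -> R).
  exact: (bounded_mfun_comp (@measurable_swap _ _ (borel E) (borel E)) bpsi).
have bs := bounded_mfun_section_mean (F s) bsw.
have mid : \int[F s]_x \int[F t]_y psi (x, y) = \int[F t]_y \int[F s]_x psi (x, y).
  by rewrite -(mean_product12 _ _ bpsi) (mean_product21 _ _ bpsi).
rewrite -(subrKA (\int[F s]_x \int[F t]_y psi (x, y))) {2}mid.
apply: (le_trans (ler_normD _ _)).
have := flow_lipschitz bt st; have /= := flow_lipschitz bs st.
by move: (M * (2 * B)) => b; lra.
Qed.

(** The increment is [h] times the rate at an intermediate time, and the rate is Lipschitz in time
    as a mean against a product. *)
Lemma flow_quadratic (phi : E -> R) (B s h : R) : bounded_mfun B (phi : borel E -> R) ->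
  0 <= s -> 0 <= h ->
  `|\int[F (s + h)]_x phi x - \int[F s]_x phi x - h * rate phi s|
  <= h * (h * (2 * (M * (2 * (M * (2 * B)))))).
Proof.
move=> bphi s0 h0; have [c /andP[sc cs] ->] := flow_mean_value bphi s0 h0.
rewrite -mulrBr normrM ger0_norm// ler_wpM2l//.
apply: le_trans (flow2_lipschitz (bounded_mfun_L2_fst bphi) _) _.
  by rewrite s0.
apply: ler_wpM2r; last by rewrite lerBlDl.
have B0 : 0 <= B := bounded_mfun_ge0 point bphi.
by rewrite !mulr_ge0// ltW.
Qed.

Definition tensor_mean n (phi : n.-tuple E -> R) (t : R) : R :=
  \int[tensor_power (F t) n]_z phi z.

(* The constant depends on phi through its bound B only: the induction step applies
   the estimate to the sections phi (x, -) uniformly in x. *)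
Lemma tensor_quadratic n : exists2 C, 0 <= C & forall (phi : n.-tuple E -> R) (B : R),
  bounded_mfun B (phi : n.-tuple (borel E) -> R) ->
  forall t h : R, 0 <= t -> 0 <= h <= 1 ->
  `|tensor_mean phi (t + h) - tensor_mean phi t
    - h * tensor_mean (hierarchy lam Gam phi) t| <= h * (h * (C * B)).
Proof.
elim: n => [|n [C C0 IH]].
  exists 0 => // phi B bphi t h _ _.
  have h0 : hierarchy lam Gam phi = fun=> 0.
    by apply/funext => y; rewrite /hierarchy big_ord0.
  rewrite mul0r mulr0 mulr0 /tensor_mean h0.
  rewrite (mean_cst (probability_setT (tensor_power (F t) 1))) mulr0 subr0.
  by rewrite !(mean_dirac _ bphi) subrr normr0.
exists (C + 2 * (M * (2 * (M * 2))) + M * (2 * (n%:R * (M * 2)))).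
  by rewrite !addr_ge0// !mulr_ge0// ltW.
move=> phi B bphi t h t0 /andP[h0 h1].
have B0 : 0 <= B := bounded_mfun_ge0 [tuple of nseq n.+1 point] bphi.
pose phix (x : E) (z : n.-tuple E) := phi (tuple_cons (x : borel E, z)).
have bphix x : bounded_mfun B (phix x : n.-tuple (borel E) -> R).
  exact: (bounded_mfun_comp (@pair1_measurable _ _ (borel E) (n.-tuple (borel E)) x)
            (bounded_mfun_tuple_cons bphi)).
pose psi u x := tensor_mean (phix x) u.
pose dpsi x := tensor_mean (hierarchy lam Gam (phix x)) t.
have bpsi u : bounded_mfun B (psi u : borel E -> R).
  exact: (bounded_mfun_section_mean (tensor_power (F u) n) (bounded_mfun_tuple_cons bphi)).
have bdpsi : bounded_mfun (n%:R * (M * (2 * B))) (dpsi : borel E -> R).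
  exact: (bounded_mfun_section_mean (tensor_power (F t) n.+1)
           (bounded_mfun_hierarchy_cons hE hlam hGam lamM bphi)).
have meanE u : tensor_mean phi u = \int[F u]_x psi u x by exact: (mean_tensorS _ bphi).
have dE : tensor_mean (hierarchy lam Gam phi) t = rate (psi t) t + \int[F t]_x dpsi x.
  exact: (mean_tensor_hierarchy hE hlam hGam lamM bphi).
have th1 := probability_setT (F (t + h)).
have bd := bounded_mfunZ h bdpsi.
have br := bounded_mfunB (bounded_mfunB (bpsi (t + h)) (bpsi t)) bd.
have e1 : `|\int[F (t + h)]_x (psi (t + h) x - psi t x - h * dpsi x)| <=
    h * (h * (C * B)).
  apply: (norm_mean th1); split; first exact: br.1.
  by move=> x; apply: IH => //; rewrite h0.
have e2 := flow_quadratic (bpsi t) t0 h0.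
have e3 : `|\int[F (t + h)]_x dpsi x - \int[F t]_x dpsi x| <=
    h * (M * (2 * (n%:R * (M * (2 * B))))).
  have := @flow_lipschitz dpsi _ t (t + h) bdpsi.
  by rewrite t0 lerDl h0 (addrC t) addrK; apply.
rewrite !meanE dE.
move: e1; rewrite (meanB th1 (bounded_mfunB (bpsi (t + h)) (bpsi t)) bd).
rewrite (meanB th1 (bpsi (t + h)) (bpsi t)) (meanZ th1 _ bdpsi) => e1.
set a := \int[F (t + h)]_x psi (t + h) x in e1 *.
set b := \int[F (t + h)]_x psi t x in e1 e2.
set c := \int[F (t + h)]_x dpsi x in e1 e3.
set a' := \int[F t]_x psi t x in e2 *.
set c' := \int[F t]_x dpsi x in e3 *.
set r := rate _ _ in e2 *.
have -> : a - a' - h * (r + c') =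
  (a - b - h * c) + (b - a' - h * r) + h * (c - c') by ring.
apply: (le_trans (ler_normD _ _)); rewrite normrM (ger0_norm h0).
apply: (le_trans (lerD (ler_normD _ _) (ler_wpM2l h0 e3))).
apply: (le_trans (lerD (lerD e1 e2) (lexx _))).
by rewrite -!mulrDr ler_wpM2l// !mulrDl; lra.
Qed.

Lemma tensor_right_derivative n (phi : n.-tuple E -> R) (B : R) :
  bounded_mfun B (phi : n.-tuple (borel E) -> R) ->
  uniform_right_derivative (tensor_mean phi) (tensor_mean (hierarchy lam Gam phi)).
Proof.
move=> bphi eta eta0; have [C C0 CP] := tensor_quadratic n.
have B0 : 0 <= B := bounded_mfun_ge0 [tuple of nseq n point] bphi.
have CB0 : 0 < C * B + 1 by rewrite ltr_wpDl// mulr_ge0.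
exists (Num.min 1 (eta / (C * B + 1))); first by rewrite lt_min ltr01 divr_gt0.
move=> t h t0 /andP[h0]; rewrite le_min => /andP[h1 heta].
have hh : 0 <= h <= 1 by rewrite ltW.
apply: (le_trans (CP phi B bphi t h t0 hh)).
rewrite mulrC ler_wpM2r ?(ltW h0)//.
move: heta; rewrite ler_pdivlMr//; apply: le_trans.
by rewrite ler_wpM2l ?(ltW h0)// lerDl.
Qed.

End boltzmann_flow.

Lemma bin_le_exp2 n m : ('C(n, m) <= 2 ^ n)%N.
Proof.
elim: n m => [|n IH] [|m]; rewrite ?bin0 ?bin0n ?expn_gt0//.
by rewrite binS expnS mul2n -addnn leq_add.
Qed.

(** The factor k comes from the hierarchy and 1/(n+1) from integrating u^n. It holds because (n+1)
    C(k+n+1, n+1) = (k+1) C(k+n+1, n). *)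
Lemma mul_bin_le_ratio (R : realFieldType) k n :
  k%:R * 'C(k.+1 + n, n)%:R / n.+1%:R <= 'C(k + n.+1, n.+1)%:R :> R.
Proof.
rewrite ler_pdivrMr ?ltr0n// -!natrM ler_nat.
have := mul_bin_left (k + n.+1) n; rewrite addnS mulnC => ->.
by rewrite addSn leq_mul// subSn ?leq_addl// addnK.
Qed.

(** * Propagation of chaos *)

Section propagation.
Context (R : realType) (E : completePseudoMetricType R).
Hypothesis hE : polish_space E.
Variables (lam : E * E -> R)
          (Gam : E * E -> probability (borel E * borel E)%type R).
Hypothesis hlam : collision_rate lam.
Hypothesis hGam : post_collisional Gam.
Hypothesis hL2 : forall phi, Cb R (E * E)%type phi -> Cb R (E * E)%type (L2 lam Gam phi).
Variable M : R.
Hypothesis M0 : 0 < M.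
Hypothesis lamM : forall z, lam z <= M.
Variable F : R -> probability (borel E) R.
Hypothesis hF : strong_solution lam Gam F.
Variables (d : nat -> measure_display) (Omega : forall N, measurableType (d N)).
Variables (P : forall N, probability (Omega N) R)
          (Z : forall N, R -> {RV (P N) >-> N.-tuple (borel E)}).
Hypothesis hZ : forall N, (0 < N)%N ->
  markov_with_generator (Z N) (@particle_generator R E lam Gam N).

Definition marginal_gap k N (iota : 'I_k -> 'I_N) (phi : k.-tuple E -> R) (t : R) : R :=
  \int[P N]_w phi (select iota (Z N t w)) - tensor_mean F phi t.

(** The rank [N0] is uniform over the injections, since the derivative of a gap averages gaps over
    all possible additional particles. *)
Definition chaotic_at (t : R) := forall k (phi : k.-tuple E -> R),
  Cb R (k.-tuple E) phi -> forall e : R, 0 < e -> exists N0, forall N, (N0 <= N)%N ->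
  forall iota : 'I_k -> 'I_N, injective iota -> `|marginal_gap iota phi t| <= e.

Let bounded_mfun_select k N (iota : 'I_k -> 'I_N) (phi : k.-tuple E -> R) (B t : R) :
  bounded_mfun B (phi : k.-tuple (borel E) -> R) ->
  bounded_mfun B (fun w => phi (select iota (Z N t w))).
Proof.
have mZ : measurable_fun setT (Z N t) by [].
exact: (bounded_mfun_comp (measurableT_comp (measurable_select iota) mZ)).
Qed.

Lemma norm_marginal_gap k N (iota : 'I_k -> 'I_N) (phi : k.-tuple E -> R) (B t : R) :
  bounded_mfun B (phi : k.-tuple (borel E) -> R) -> `|marginal_gap iota phi t| <= 2 * B.
Proof.
move=> bphi; apply: (le_trans (ler_normB _ _)); rewrite mulr_natl mulr2n lerD//.
  exact: (norm_mean (probability_setT _) (bounded_mfun_select iota t bphi)).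
exact: (norm_mean (probability_setT (tensor_power (F t) k)) bphi).
Qed.

Let gap_derivative k N (iota : 'I_k -> 'I_N) (phi : k.-tuple E -> R) (t : R) : R :=
  \int[P N]_w particle_generator lam Gam (phi \o select iota) (Z N t w)
  - tensor_mean F (hierarchy lam Gam phi) t.

Let Cb_select k N (iota : 'I_k -> 'I_N) (phi : k.-tuple E -> R) :
  Cb R (k.-tuple E) phi -> Cb R (N.-tuple E) (phi \o select iota).
Proof.
move=> /CbP[cphi [B bB]]; apply/CbP; split; last by exists B => z; exact: bB.
move=> z; exact: (cvg_comp _ _ (@select_continuous E _ _ iota z) (cphi _)).
Qed.

Let marginal_gap_right_derivative k N (iota : 'I_k -> 'I_N) (phi : k.-tuple E -> R) :
  (0 < N)%N -> Cb R (k.-tuple E) phi ->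
  uniform_right_derivative (marginal_gap iota phi) (gap_derivative iota phi).
Proof.
move=> N0 phiCb; have [B bphi] := Cb_bounded_mfun hE phiCb.
apply: uniform_right_derivativeB.
  apply: (markov_right_derivative hE (hZ N0) _ (Cb_select iota phiCb)) => psi.
  exact: (particle_generator_Cb hE hlam hGam hL2 M0 lamM).
exact: (tensor_right_derivative hE hlam hGam M0 lamM hF bphi).
Qed.

(** The error of order 1/N has two equal halves, hence the factor 2: collisions between followed
    particles, and the replacement of the weight (N - k)/N of the remaining particles by 1. *)
Let norm_gap_derivative k N (iota : 'I_k -> 'I_N) (phi : k.-tuple E -> R) (B e t : R) :
  (0 < N)%N -> injective iota -> 0 <= e -> Cb R (k.-tuple E) phi ->
  bounded_mfun B (phi : k.-tuple (borel E) -> R) ->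
  (forall jota : 'I_k.+1 -> 'I_N, injective jota ->
    `|marginal_gap jota (hierarchy lam Gam phi) t| <= e) ->
  `|gap_derivative iota phi t| <= e + N%:R^-1 * (2 * (k%:R * (k%:R * (M * (2 * B))))).
Proof.
move=> N0 iotaI e0 phiCb bphi gap_le.
have P1 := probability_setT (P N).
have N0' : 0 < N%:R :> R by rewrite ltr0n.
set S := iota @: 'I_k; have cS : #|S| = k by rewrite card_imset// card_ord.
have kN : (k <= N)%N by rewrite -cS -[leqRHS]card_ord max_card.
have cS' : #|~: S| = (N - k)%N by rewrite cardsCs finset.setCK cS card_ord.
have bh := bounded_mfun_hierarchy hE hlam hGam lamM bphi.
set b := k%:R * (M * (2 * B)) in bh *.
have notS j : j \in ~: S -> forall a, iota a != j.
  by rewrite inE => jS a; apply: contraNneq jS => <-; exact: imset_f.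
set h := hierarchy lam Gam phi in bh *.
have bgen : exists C, bounded_mfun C
    (fun w => particle_generator lam Gam (phi \o select iota) (Z N t w)).
  have [C bC] := Cb_bounded_mfun hE (particle_generator_Cb hE hlam hGam hL2 M0 lamM
    (Cb_select iota phiCb)).
  have mZ : measurable_fun setT (Z N t) by [].
  by exists C; exact: (bounded_mfun_comp mZ bC).
have [C {}bgen] := bgen.
pose g j w := h (select (consf j iota) (Z N t w)).
have bg j : bounded_mfun b (g j) by exact: (bounded_mfun_select (consf j iota) t bh).
have bsum := bounded_mfun_sum (index_enum 'I_N) (mem (~: S)) bg.
have bsumN := bounded_mfunZ N%:R^-1 bsum.
have e1 : `|\int[P N]_w (particle_generator lam Gam (phi \o select iota) (Z N t w) -
    N%:R^-1 * \sum_(j in ~: S) g j w)| <= N%:R^-1 * (k%:R * b).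
  apply: (norm_mean P1); split; first exact: (bounded_mfunB bgen bsumN).1.
  by move=> w; exact: (generator_select hlam hGam M0 lamM _ iotaI bphi).
rewrite (meanB P1 bgen bsumN) (meanZ P1 _ bsum) (mean_sum P1 _ _ bg) in e1.
rewrite /gap_derivative -/h.
have e2 : `|tensor_mean F h t| <= b.
  exact: (norm_mean (probability_setT (tensor_power (F t) k.+1)) bh).
have gE j : \int[P N]_w g j w = marginal_gap (consf j iota) h t + tensor_mean F h t.
  by rewrite subrK.
have e3 : `|\sum_(j in ~: S) marginal_gap (consf j iota) h t| <= (N - k)%:R * e.
  rewrite (le_trans (ler_norm_sum _ _ _))// -[X in X%:R * _]cS' mulr_natl -sumr_const.
  by apply: ler_sum => j /notS jS; exact: (gap_le _ (consf_inj iotaI jS)).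
rewrite (eq_bigr _ (fun j _ => gE j)) big_split/= sumr_const cS' in e1.
move: e1 e2 e3; rewrite -[_ *+ (N - k)]mulr_natl natrB//.
have kN' : k%:R <= N%:R :> R by rewrite ler_nat.
move: (\int[_]_w _) (\sum_(j in _) _) (tensor_mean F h t) => x y z e1 e2 e3.
have -> : x - z = (x - N%:R^-1 * (y + (N%:R - k%:R) * z)) + N%:R^-1 * (y - k%:R * z).
  by field; rewrite gt_eqF.
have k0 : 0 <= k%:R :> R by [].
have e4 : `|y - k%:R * z| <= N%:R * e + k%:R * b.
  rewrite (le_trans (ler_normB _ _))// normrM (ger0_norm k0) lerD ?ler_wpM2l//.
  by apply: (le_trans e3); rewrite ler_wpM2r// gerBl.
rewrite (le_trans (ler_normD _ _))// normrM [X in _ + X * _]ger0_norm ?invr_ge0//.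
apply: (le_trans (lerD e1 (ler_wpM2l _ e4))); first by rewrite invr_ge0.
rewrite mulrDr mulKf ?gt_eqF// -/b addrCA lerD2l -mulrDr.
by rewrite [2 * _]mulr_natl mulr2n.
Qed.

(* The gap of phi is driven by the gaps of its hierarchy, a function of one more
   particle whose bound grows by a factor 2 k M; the binomials absorb the factors k
   and the 1 / n! of the iterated time integrals. *)
Lemma marginal_gap_iterated n (t0 T : R) : 0 <= t0 -> 0 <= T -> chaotic_at t0 ->
  forall k (phi : k.-tuple E -> R) (B e : R), Cb R (k.-tuple E) phi ->
  bounded_mfun B (phi : k.-tuple (borel E) -> R) -> 0 < e ->
  exists N0, forall N, (N0 <= N)%N -> forall iota : 'I_k -> 'I_N, injective iota ->
  forall u : R, 0 <= u <= T ->
    `|marginal_gap iota phi (t0 + u)| <= e + 2 * B * 'C(k + n, n)%:R * (2 * M * u) ^+ n.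
Proof.
move=> t00 T0 ch0; elim: n => [|n IH] k phi B e phiCb bphi e0.
  exists 0%N => N _ iota _ u _; rewrite bin0 expr0 !mulr1.
  by rewrite (le_trans (norm_marginal_gap iota _ bphi))// lerDr ltW.
have bh := bounded_mfun_hierarchy hE hlam hGam lamM bphi.
have hCb := hierarchy_Cb hE hlam hGam hL2 M0 lamM phiCb.
have B0 : 0 <= B := bounded_mfun_ge0 [tuple of nseq k point] bphi.
have T1 : 0 < T + 1 by rewrite ltr_wpDl.
(* The derivative carries [e'] twice, once for the gap of the hierarchy and once for the 1/N error.
   Integrated up to T this is at most e/2, and the gap at [t0] takes the other half. *)
pose e' := e / (4 * (T + 1)).
have e'0 : 0 < e' by rewrite divr_gt0// mulr_gt0.
have [N1 HN1] := IH _ _ _ _ hCb bh e'0.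
have [N2 HN2] := ch0 _ _ phiCb _ (divr_gt0 e0 (ltr0n R 2)).
set q := 2 * (k%:R * (k%:R * (M * (2 * B)))).
have q0 : 0 <= q by rewrite !mulr_ge0// ltW.
have q1 : 0 < q + 1 by rewrite ltr_wpDl.
have [N3 HN3] := small_inv_nat (divr_gt0 e'0 q1).
exists (maxn N1 (maxn N2 N3.+1)) => N; rewrite !geq_max => /and3P[NN1 NN2 NN3] iota iotaI.
have N0 : (0 < N)%N by exact: leq_trans NN3.
have Nq : N%:R^-1 * q <= e'.
  have N1q : N%:R^-1 <= e' / (q + 1).
    apply: le_trans (ltW HN3); rewrite lef_pV2 ?posrE ?ltr0n// ler_nat//.
  apply: (le_trans (ler_wpM2r q0 N1q)); rewrite mulrAC ler_pdivrMr//.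
  by rewrite ler_wpM2l ?(ltW e'0)// lerDl.
pose c := 2 * (k%:R * (M * (2 * B))) * 'C(k.+1 + n, n)%:R * (2 * M) ^+ n.
have c0 : 0 <= c by rewrite !mulr_ge0 ?exprn_ge0 ?mulr_ge0// ltW.
have dle (u : R) : 0 <= u <= T -> `|gap_derivative iota phi (t0 + u)| <= 2 * e' + c * u ^+ n.
  move=> uT; have u0 : 0 <= u by have /andP[] := uT.
  have ec0 : 0 <= e' + c * u ^+ n by rewrite (addr_ge0 (ltW e'0))// mulr_ge0// exprn_ge0.
  have gap_le jota : injective jota ->
      `|@marginal_gap k.+1 N jota (hierarchy lam Gam phi) (t0 + u)| <= e' + c * u ^+ n.
    by move=> jI; rewrite -[c * _]mulrA -exprMn; exact: HN1.
  have := norm_gap_derivative N0 iotaI ec0 phiCb bphi gap_le; rewrite -/q.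
  by move=> H; apply: (le_trans H); rewrite addrAC lerD2r mulr_natl mulr2n lerD2l.
move=> u uT; have /andP[u0 uleT] := uT.
have urd := marginal_gap_right_derivative iota N0 phiCb.
have := uniform_right_derivative_le urd t00 _ c0 dle uT.
rewrite mulr_ge0 ?(ltW e'0)// => /(_ isT).
set x := marginal_gap iota phi (t0 + u); set y := marginal_gap iota phi t0 => xy.
have yle : `|y| <= e / 2 by exact: HN2.
rewrite -[x](subrK y) (le_trans (ler_normD _ _))//.
apply: (le_trans (lerD xy yle)); rewrite addrAC lerD//.
  have : 2 * e' * u <= e / 2.
    apply: (@le_trans _ _ (2 * e' * (T + 1))).
      apply: ler_wpM2l; first by rewrite mulr_ge0 ?(ltW e'0).
      by rewrite (le_trans uleT)// lerDl.
    by rewrite /e' le_eqVlt; apply/orP; left; apply/eqP; field; rewrite gt_eqF.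
  by move=> ?; lra.
rewrite [(2 * M * u) ^+ n.+1]exprMn [(2 * M) ^+ n.+1]exprS /c.
have binle := @mul_bin_le_ratio R k n.
have w0 : 0 <= 2 * B * (2 * M) * (2 * M) ^+ n * u ^+ n.+1.
  by rewrite !mulr_ge0 ?exprn_ge0 ?mulr_ge0// ltW.
have n10 : n.+1%:R != 0 :> R by rewrite pnatr_eq0.
move: binle w0 n10; move: ('C(k + n.+1, n.+1)%:R) ('C(k.+1 + n, n)%:R) => b1 b2.
move: (n.+1%:R) ((2 * M) ^+ n) (u ^+ n.+1) (k%:R) => m p v k' binle w0 n10.
have := ler_wpM2l w0 binle.
have -> : 2 * B * (2 * M) * p * v * (k' * b2 / m) =
  2 * (k' * (M * (2 * B))) * b2 * p * v / m by field.
by have -> : 2 * B * (2 * M) * p * v * b1 = 2 * B * b1 * (2 * M * p * v) by ring.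
Qed.

(** Since C(k+n, n) <= 2^(k+n), having 2Mu <= 1/4 leaves 2^k 2^(-n), which tends to 0; it is bounded
    through 2^(-n) <= 1/(n+1) to choose n easily. *)
Let T := (8 * M)^-1.

Let T_gt0 : 0 < T. Proof. by rewrite invr_gt0 mulr_gt0. Qed.

Let exp_bin_le k n (u : R) : 0 <= u <= T ->
  'C(k + n, n)%:R * (2 * M * u) ^+ n <= 2 ^+ k / n.+1%:R.
Proof.
move=> /andP[u0 uT].
have v0 : 0 <= 2 * M * u by rewrite !mulr_ge0// ltW.
have v1 : 2 * M * u <= 4^-1.
  apply: le_trans (ler_wpM2l _ uT) _; first by rewrite mulr_ge0// ltW.
  by rewrite /T le_eqVlt; apply/orP; left; apply/eqP; field; rewrite gt_eqF.
have binR : 'C(k + n, n)%:R <= 2 ^+ (k + n) :> R by rewrite -natrX ler_nat bin_le_exp2.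
have vn : (2 * M * u) ^+ n <= 4^-1 ^+ n by rewrite lerXn2r// nnegrE.
apply: le_trans (ler_pM _ (exprn_ge0 _ v0) binR vn) _; first exact: ler0n.
rewrite exprD -mulrA ler_wpM2l ?exprn_ge0//.
have -> : 2 ^+ n * 4^-1 ^+ n = (2 ^+ n)^-1 :> R.
  by rewrite -exprVn -exprMn; congr (_ ^+ _); lra.
by rewrite lef_pV2 ?posrE ?exprn_gt0// -natrX ler_nat ltn_expl.
Qed.

(** The depth n is fixed first, from e, the bound of [phi] and k; only then is N sent to infinity.
    The step length depends on [M] alone, so finitely many steps reach any time. *)
Lemma chaotic_at_step (t0 u : R) : 0 <= t0 -> 0 <= u <= T ->
  chaotic_at t0 -> chaotic_at (t0 + u).
Proof.
move=> t00 uT ch k phi phiCb e e0; have [B bphi] := Cb_bounded_mfun hE phiCb.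
have B0 : 0 <= B := bounded_mfun_ge0 [tuple of nseq k point] bphi.
pose b := 2 * B * 2 ^+ k.
have b0 : 0 <= b by rewrite !mulr_ge0.
have b1 : 0 < b + 1 by rewrite ltr_wpDl.
have e20 : 0 < e / 2 by rewrite divr_gt0.
have [n nP] := small_inv_nat (divr_gt0 e20 b1).
have [N0 HN0] := marginal_gap_iterated n t00 (ltW T_gt0) ch phiCb bphi e20.
exists N0 => N NN0 iota iotaI; apply: (le_trans (HN0 N NN0 iota iotaI u uT)).
rewrite [leRHS]splitr lerD2l -mulrA.
apply: le_trans (ler_wpM2l _ (exp_bin_le k n uT)) _; first by rewrite mulr_ge0.
rewrite mulrA -/b; apply: (le_trans (ler_wpM2l b0 (ltW nP))).
by rewrite mulrCA ler_piMr ?(ltW e20)// ler_pdivrMr// mul1r lerDl.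
Qed.

Lemma chaotic_at_propagates : chaotic_at 0 -> forall t, 0 <= t -> chaotic_at t.
Proof.
move=> ch0 t t0.
suff H j : forall s, 0 <= s <= j%:R * T -> chaotic_at s.
  apply: (H (Num.truncn (t / T)).+1); rewrite t0 -ler_pdivrMr// ltW//.
  exact: truncnS_gt.
elim: j => [|j IH] s /andP[s0].
  by rewrite mul0r => s0'; have -> : s = 0 by apply/eqP; rewrite eq_le s0'.
rewrite -natr1 mulrDl mul1r => sj.
have [sT|Ts] := leP s T.
  by rewrite -[s]add0r; apply: chaotic_at_step => //; rewrite s0.
rewrite -[s](subrK T); apply: chaotic_at_step; rewrite ?subr_ge0 ?(ltW Ts)//.
  by rewrite (ltW T_gt0)/=.
by apply: IH; rewrite subr_ge0 (ltW Ts)/= lerBlDr.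
Qed.

End propagation.

(** The image of [iota], listed in order and followed by its complement, contains each index exactly
    once; the permutation reads this list. *)
Lemma perm_extends_injection k n (iota : 'I_k -> 'I_(k + n)) : injective iota ->
  exists s : 'S_(k + n), forall i, s (lshift n i) = iota i.
Proof.
move=> iotaI; pose A := codom iota; pose q := A ++ enum [predC A].
have qU : uniq q.
  rewrite cat_uniq enum_uniq andbT /A codomE map_inj_uniq// enum_uniq/=.
  by apply/hasPn => x; rewrite mem_enum.
have memq x : x \in q by rewrite mem_cat mem_enum inE /=; case: (x \in A).
have sq : size q = (k + n)%N.
  have /perm_size -> : perm_eq q (enum 'I_(k + n)).
    by apply: uniq_perm; rewrite ?enum_uniq// => x; rewrite memq mem_enum.
  by rewrite size_enum_ord.
pose f (i : 'I_(k + n)) := nth i q i.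
have fI : injective f.
  move=> i j /eqP; rewrite /f (set_nth_default i j) ?sq//.
  by rewrite nth_uniq ?sq// => /eqP/val_inj.
exists (perm fI) => i; rewrite permE /f /= nth_cat size_codom card_ord ltn_ord.
by rewrite /A codomE (nth_map i) ?size_enum_ord// nth_ord_enum.
Qed.

(** * Chaos at the initial time for arbitrary distinct particles *)

Section initial_chaos.
Context (R : realType) (E : completePseudoMetricType R).
Hypothesis hE : polish_space E.
Variable f0 : probability (borel E) R.
Variable f0N : forall N, probability (N.-tuple (borel E)) R.
Hypothesis hsym : forall N, (0 < N)%N -> symmetric_law (f0N N).
Hypothesis hchaos : chaotic f0 f0N.
Variables (d : nat -> measure_display) (Omega : forall N, measurableType (d N)).
Variables (P : forall N, probability (Omega N) R)
          (Z : forall N, R -> {RV (P N) >-> N.-tuple (borel E)}).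
Hypothesis hZ0 : forall N, (0 < N)%N -> forall A, measurable A ->
     distribution (P N) (Z N 0) A = f0N N A.

Lemma mean_initial k N (iota : 'I_k -> 'I_N) (phi : k.-tuple E -> R) (B : R) :
  (0 < N)%N -> bounded_mfun B (phi : k.-tuple (borel E) -> R) ->
  \int[P N]_w phi (select iota (Z N 0 w)) = \int[f0N N]_z phi (select iota z).
Proof.
move=> N0 bphi.
have bs : bounded_mfun B (phi \o select iota : N.-tuple (borel E) -> R).
  exact: (bounded_mfun_comp (measurable_select iota) bphi).
rewrite -(mean_pushforward (P N) (Z N 0) bs) /Rintegral; congr fine.
by apply: eq_measure_integral => A mA _; exact: hZ0.
Qed.

Lemma mean_symmetric_law k n (iota : 'I_k -> 'I_(k + n)) (phi : k.-tuple E -> R) (B : R) :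
  (0 < k + n)%N -> injective iota -> bounded_mfun B (phi : k.-tuple (borel E) -> R) ->
  \int[f0N (k + n)]_z phi (select iota z) =
  \int[distribution (f0N (k + n)) (@first _ (borel E) k n)]_z phi z.
Proof.
move=> N0 /perm_extends_injection[s sE] bphi.
have bf := bounded_mfun_comp (@measurable_first _ (borel E) k n) bphi.
pose sel := mfun_Sub (mem_set (@measurable_select _ (borel E) _ _ (s : _ -> 'I_(k + n)))).
rewrite (mean_pushforward _ (@first _ (borel E) k n) bphi).
transitivity (\int[distribution (f0N (k + n)) sel]_z phi (first z)).
  rewrite (mean_pushforward _ sel bf); apply: eq_Rintegral => z _ /=; congr phi.
  by apply: eq_from_tnth => i; rewrite !tnth_mktuple sE.
rewrite /Rintegral; congr fine; apply: eq_measure_integral => A mA _.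
exact: (hsym N0 s mA).
Qed.

Lemma chaotic_at0 (F : R -> probability (borel E) R) : F 0 = f0 -> chaotic_at F Z 0.
Proof.
move=> F0 k phi phiCb e e0; have [B bphi] := Cb_bounded_mfun hE phiCb.
(* The chaos hypothesis starts at one particle; with no particle, both means equal the value at the
   empty tuple. *)
case: k phi phiCb bphi => [|k] phi phiCb bphi.
  exists 0%N => N _ iota _; rewrite /marginal_gap /tensor_mean (mean_dirac _ bphi).
  have -> : (fun w => phi (select iota (Z N 0 w))) = (fun=> phi [tuple]).
    by apply/funext => w; rewrite tuple0.
  by rewrite (mean_cst (probability_setT (P N))) subrr normr0 ltW.
have [n0 _ n0P] := (cvgrPdist_le _ _).1 (hchaos (ltn0Sn k) phiCb) _ e0.
exists (k.+1 + n0)%N => N NN0 iota iotaI.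
have NE : N = (k.+1 + (N - k.+1))%N by rewrite subnKC// (leq_trans _ NN0)// leq_addr.
move: (N - k.+1)%N NE NN0 iota iotaI => n -> NN0 iota iotaI; rewrite leq_add2l in NN0.
rewrite /marginal_gap (mean_initial iota _ bphi)// (mean_symmetric_law _ iotaI bphi)//.
by rewrite distrC /tensor_mean F0; exact: n0P.
Qed.

End initial_chaos.

(** * The weak Boltzmann equation *)

Section weak_solution.
Context (R : realType) (E : completePseudoMetricType R).
Hypothesis hE : polish_space E.
Variables (lam : E * E -> R)
          (Gam : E * E -> probability (borel E * borel E)%type R).
Hypothesis hlam : collision_rate lam.
Hypothesis hGam : post_collisional Gam.
Variable M : R.
Hypothesis M0 : 0 < M.
Hypothesis lamM : forall z, lam z <= M.

Lemma boltzmann_rhsE (f : probability (borel E) R) (phi : E -> R) (B : R) :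
  bounded_mfun B (phi : borel E -> R) ->
  boltzmann_rhs lam Gam f phi =
  \int[product_probability f f]_z L2 lam Gam (fun p => phi p.1) z.
Proof.
move=> bphi; apply: eq_Rintegral => z _; congr (_ * _).
have b := bounded_mfunB bphi (bounded_mfun_cst (borel E) (phi z.1)).
exact: (mean_pushforward (Gam z) (@fst (borel E) (borel E)) b).
Qed.

Lemma flow_strong_solution (f0 : probability (borel E) R) :
  strong_solution lam Gam (flow hE hlam hGam M0 lamM f0).
Proof.
move=> phi B bphi; exists (flow_series hE hlam hGam M0 lamM f0 phi) => t t0.
  exact: mean_flow t0 bphi.
exact: is_derive_flow_series t0 bphi.
Qed.

Lemma strong_solution_weak (F : R -> probability (borel E) R) :
  strong_solution lam Gam F -> weak_boltzmann_solution lam Gam (F 0) F.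
Proof.
move=> hF; split=> // phi /CbP[cphi [B phiB]].
have bphi : bounded_mfun B (phi : borel E -> R).
  by split=> //; exact: continuous_measurable_polish.
split=> [t t0|].
  have [f fE df] := hF phi B bphi; rewrite (boltzmann_rhsE _ bphi).
  (* The means along [F] agree with [f] at nonnegative times only, which form a neighbourhood of the
     positive time t. *)
  apply: (@near_eq_is_derive _ _ _ f) (df t (ltW t0)).
  near=> u; rewrite fE//; near: u; apply: filterS (fun v (v0 : 0 < v) => ltW v0) _; exact: lt_nbhsr.
(* The right derivative at 0 is read off the quadratic remainder of [flow_quadratic] at s = 0. *)
rewrite (boltzmann_rhsE _ bphi); apply/cvgrPdist_le => e e0.
have B0 : 0 <= B := bounded_mfun_ge0 point bphi.
pose c := 2 * (M * (2 * (M * (2 * B)))).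
have c0 : 0 <= c by rewrite !mulr_ge0// ltW.
have c1 : 0 < c + 1 by rewrite ltr_wpDl.
near=> h.
have h0 : 0 < h by near: h; exact: nbhs_right_gt.
have hc : h <= e / (c + 1) by near: h; apply: nbhs_right_le; rewrite divr_gt0.
have := flow_quadratic hE hlam hGam M0 lamM hF bphi (lexx 0) (ltW h0).
rewrite add0r -/c; move: (\int[F h]_x phi x) (\int[F 0]_x phi x).
move: (Rintegral (product_probability _ _) _ _) => z x y H.
have -> : z - h^-1 * (x - y) = - (h^-1 * (x - y - h * z)) by field; rewrite gt_eqF.
rewrite normrN normrM gtr0_norm ?invr_gt0// ler_pdivrMl//.
apply: (le_trans H); rewrite ler_pM2l//.
apply: (le_trans (ler_wpM2r c0 hc)).
by rewrite mulrAC ler_pdivrMr// ler_wpM2l ?(ltW e0)// lerDl.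
Unshelve. all: by end_near.
Qed.

End weak_solution.

Theorem theorem4p1 (R : realType) (E : completePseudoMetricType R)
  (hE : polish_space E)
  (lam : E * E -> R)
  (Gam : E * E -> probability (borel E * borel E)%type R)
  (hlam : collision_rate lam)
  (hGam : post_collisional Gam)
  (hL2 : forall phi, Cb R (E * E)%type phi -> Cb R (E * E)%type (L2 lam Gam phi))
  (Lam : R) (hLam : forall z, lam z <= Lam)
  (f0 : probability (borel E) R)
  (f0N : forall N, probability (N.-tuple (borel E)) R)
  (hsym : forall N, (0 < N)%N -> symmetric_law (f0N N))
  (hchaos : chaotic f0 f0N)
  (d : nat -> measure_display) (Omega : forall N, measurableType (d N))
  (P : forall N, probability (Omega N) R)
  (Z : forall N, R -> {RV (P N) >-> N.-tuple (borel E)})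
  (hZ0 : forall N, (0 < N)%N -> forall A, measurable A ->
     distribution (P N) (Z N 0) A = f0N N A)
  (hZ : forall N, (0 < N)%N ->
     markov_with_generator (Z N) (@particle_generator R E lam Gam N)) :
  exists f : R -> probability (borel E) R,
    (forall t, 0 < t -> forall s, (0 < s)%N ->
       forall phi, Cb R (s.-tuple E) phi ->
         ('E_(P (s + n)%N)[fun w => phi (first (Z (s + n)%N t w))])%E
           @[n --> \oo] --> (\int[tensor_power (f t) s]_z phi z)%:E) /\
    weak_boltzmann_solution lam Gam f0 f.
Proof.
(* [Lam] may be 0, whereas the construction divides by the rate. *)
have Lam0 : 0 < Lam + 1.
  by rewrite ltr_wpDl// (le_trans _ (hLam point))//; have [] := hlam.
have lamM z : lam z <= Lam + 1 by rewrite (le_trans (hLam z))// lerDl.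
pose F := flow hE hlam hGam Lam0 lamM f0.
have F0 : F 0 = f0 by exact: flow0.
have hF : strong_solution lam Gam F := flow_strong_solution hE hlam hGam Lam0 lamM f0.
have ch := chaotic_at_propagates hE hlam hGam hL2 Lam0 lamM hF hZ
  (chaotic_at0 hE hsym hchaos hZ0 F0).
exists F; split; last by rewrite -F0; exact: (strong_solution_weak hE hlam hGam Lam0 lamM hF).
move=> t t0 s s0 phi phiCb; have [B bphi] := Cb_bounded_mfun hE phiCb.
(* [first] is the selection along [lshift], so the claim is chaos at time t for one particular
   injection. *)
rewrite (_ : (fun n => _) = (fun n =>
    (\int[P (s + n)%N]_w phi (select (lshift n) (Z (s + n)%N t w)))%:E)).
  apply: cvg_EFin; first exact: nearW.
  apply/cvgrPdist_le => e e0; have [N0 HN0] := ch t (ltW t0) s phi phiCb e e0.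
  exists N0 => // n /= nN0; rewrite distrC; apply: HN0; last exact: lshift_inj.
  by rewrite (leq_trans nN0)// leq_addl.
apply/funext => n; rewrite unlock.
have mZ : measurable_fun setT (Z (s + n)%N t) by [].
apply/esym/(EFin_mean (probability_setT (P (s + n)%N)) (B := B)).
exact: (bounded_mfun_comp (measurableT_comp (measurable_select (lshift n)) mZ) bphi).
Qed.
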